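(* Assume projective determinacy (PD). Let $X$ be a separable metrizable projective space which is not in $\Sigma^1_1$. Let $n \geq 2$ be the least natural number such that $X$ is in $\Sigma^1_n$. Then the measurable space $C_p^*(X)$ is Borel-$\Pi^1_n$-complete.
   Context: **Projective determinacy.** PD is the statement that every infinite game $G(\mathbb N, P)$ with a projective payoff set $P \subseteq \mathbb N^{\mathbb N}$ is determined. **The space $C_p^*(X)$.** For a separable metrizable space $X$, $C_p^*(X)$ denotes the measurable space of all real bounded continuous functions on $X$, equipped with the Borel $\sigma$-algebra generated by the topology of pointwise convergence on $X$. **Standard Borel spaces.** A measurable space is a standard Borel space if it is isomorphic (as a measurable space) to a Polish space endowed with its Borel $\sigma$-algebra. **Projective classes.** $\Sigma^1_n$ and $\Pi^1_n$ ($n \in \mathbb N$, $n\ge 1$) are the usual (boldface) projective classes of subsets of Polish spaces; $\Gamma(Y)$ denotes the family of subsets of $Y$ belonging to the class $\Gamma$. Let $\Gamma$ be one of these classes. - If $Y$ is a standard Borel space and $A \subseteq Y$, then $A \in \Gamma(Y)$ means that for some (equivalently, any) Polish space $P$ and some (equivalently, any) Borel isomorphism $f \colon Y \to P$, we have $f(A) \in \Gamma(P)$. - A separable metrizable space $X$ is in $\Gamma$ if for some (equivalently, any) Polish space $P$ and some (equivalently, any) homeomorphism $f$ of $X$ into $P$ (i.e. onto its image $f(X)$ with the subspace topology), we have $f(X) \in \Gamma(P)$. - A separable metrizable space is projective if it is in $\Sigma^1_n$ for some $n \in \mathbb N$. **Borel-Wadge reducibility.** For measurable spaces $S, T$ and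 subsets $A \subseteq S$, $B \subseteq T$, write $(A,S) \leq_B (B,T)$ if there is a measurable map $f \colon S \to T$ with $A = f^{-1}(B)$. **Hardness and completeness.** Let $\Gamma$ be one of the classes $\Sigma^1_n$, $\Pi^1_n$. - A subset $A$ of a standard Borel space $Y$ is Borel-$\Gamma$-hard in $Y$ if for every standard Borel space $S$ and every $B \in \Gamma(S)$ we have $(B,S) \leq_B (A,Y)$. It is Borel-$\Gamma$-complete in $Y$ if moreover $A \in \Gamma(Y)$. - A measurable space $M$ is Borel-$\Gamma$-complete if for some (equivalently, any) standard Borel space $Y$ and some (equivalently, any) isomorphism of measurable spaces $f$ of $M$ into $Y$ (i.e. onto $f(M)$ with the $\sigma$-algebra induced from $Y$), the set $f(M)$ is Borel-$\Gamma$-complete in $Y$. *)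

(* Defs.v *)
From HB Require Import structures.
From mathcomp Require Import all_boot all_order all_algebra.
From mathcomp Require Import all_classical all_reals all_analysis.

Set Implicit Arguments.
Unset Strict Implicit.
Unset Printing Implicit Defensive.

Import Order.TTheory GRing.Theory Num.Theory.
Import numFieldNormedType.Exports.

Local Open Scope classical_set_scope.
Local Open Scope ring_scope.

Definition homeomorphism (S T : topologicalType) (f : S -> T) : Prop :=
  continuous f /\
  exists2 g : T -> S, continuous g & cancel f g /\ cancel g f.

(* Homeomorphism onto [range f] with its subspace topology. *)
Definition embedding (S T : topologicalType) (f : S -> T) : Prop :=
  [/\ injective f, continuous f &
    forall U : set S, open U ->
      exists2 V : set T, open V & f @` U = V `&` range f].

Definition separable (T : topologicalType) : Prop :=
  exists2 D : set T, countable D & dense D.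

Definition metrizable (R : realType) (T : topologicalType) : Prop :=
  exists (M : metricType R) (h : T -> M), homeomorphism h.

(* The library's [completeType] axiom, without its requirement of a point. *)
Definition metric_complete (R : realType) (M : metricType R) : Prop :=
  forall F : set_system M, ProperFilter F -> cauchy F -> exists x : M, F --> x.

Definition polish (R : realType) (T : topologicalType) : Prop :=
  separable T /\
  exists (M : metricType R) (h : T -> M), metric_complete M /\ homeomorphism h.

Definition baire_space : Type := prod_topology (fun _ : nat => nat).

HB.instance Definition _ := Pointed.on baire_space.
HB.instance Definition _ := Nbhs.on baire_space.
HB.instance Definition _ := Topological.on baire_space.

(* A pointclass selects, in every space, a family of subsets; the projective
   ones below are only meaningful in Polish spaces. *)
Definition pointclass : Type := forall P : topologicalType, set (set P).

(* Boldface Sigma^1_n for n >= 1: Sigma^1_1 sets are the projections along the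
   Baire space of closed sets, and Sigma^1_(n+1) sets are the projections along
   the Baire space of Pi^1_n sets.  The index 0 is unused: no set belongs to the
   class. *)
Fixpoint Sigma1 (n : nat) (P : topologicalType) (A : set P) {struct n} : Prop :=
  match n with
  | 0 => False
  | m.+1 => exists2 C : set (P * baire_space),
      (if m is 0 then closed C else Sigma1 m (~` C)) & A = fst @` C
  end.

Definition Pi1 (n : nat) (P : topologicalType) (A : set P) : Prop :=
  Sigma1 n (~` A).

Definition space_in (R : realType) (Gamma : pointclass) (X : topologicalType)
    : Prop :=
  exists (P : topologicalType) (f : X -> P),
    [/\ polish R P, embedding f & Gamma P (range f)].

Definition projective_space (R : realType) (X : topologicalType) : Prop :=
  exists2 n : nat, (1 <= n)%N & space_in R (Sigma1 n) X.

(* In the game with payoff A, the players alternately choose x 0, x 1, x 2, ...;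
   player I chooses the terms of even index and wins iff x \in A.  A strategy
   maps the sequence of all previous moves to the next move. *)
Definition follows_I (s : seq nat -> nat) (x : baire_space) : Prop :=
  forall k : nat, x k.*2 = s (mkseq x k.*2).

Definition follows_II (s : seq nat -> nat) (x : baire_space) : Prop :=
  forall k : nat, x k.*2.+1 = s (mkseq x k.*2.+1).

Definition determined (A : set baire_space) : Prop :=
  (exists s, forall x, follows_I s x -> A x) \/
  (exists s, forall x, follows_II s x -> ~ A x).

Definition projective_determinacy : Prop :=
  forall A : set baire_space,
    (exists2 n : nat, (1 <= n)%N & Sigma1 n A) -> determined A.

(* A pointed topological space with its Borel sigma-algebra. *)
Notation borel T := (g_sigma_algebraType (@open T)).

Definition measurable_iso d d' (S : measurableType d) (T : measurableType d')
    (f : S -> T) : Prop :=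
  measurable_fun setT f /\
  exists2 g : T -> S, measurable_fun setT g & cancel f g /\ cancel g f.

(* Isomorphism onto [range f] with the induced sigma-algebra. *)
Definition measurable_embedding d d' (S : measurableType d)
    (T : measurableType d') (f : S -> T) : Prop :=
  [/\ injective f, measurable_fun setT f &
    forall A : set S, measurable A ->
      exists2 B : set T, measurable B & f @` A = B `&` range f].

Definition standard_borel (R : realType) d (Y : measurableType d) : Prop :=
  exists (P : ptopologicalType) (f : Y -> borel P),
    polish R P /\ measurable_iso f.

(* A \in Gamma(Y) for a standard Borel space Y. *)
Definition in_class (R : realType) (Gamma : pointclass)
    d (Y : measurableType d) (A : set Y) : Prop :=
  exists (P : ptopologicalType) (f : Y -> borel P),
    [/\ polish R P, measurable_iso f & Gamma P (f @` A)].

Definition borel_wadge d d' (S : measurableType d) (T : measurableType d')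
    (A : set S) (B : set T) : Prop :=
  exists2 f : S -> T, measurable_fun setT f & A = f @^-1` B.

Definition borel_hard (R : realType) (Gamma : pointclass)
    d (Y : measurableType d) (A : set Y) : Prop :=
  forall d' (S : measurableType d') (B : set S),
    standard_borel R S -> in_class R Gamma B -> borel_wadge B A.

Definition borel_complete (R : realType) (Gamma : pointclass)
    d (Y : measurableType d) (A : set Y) : Prop :=
  borel_hard R Gamma A /\ in_class R Gamma A.

Definition borel_complete_space (R : realType) (Gamma : pointclass)
    d (M : measurableType d) : Prop :=
  exists d' (Y : measurableType d') (f : M -> Y),
    [/\ standard_borel R Y, measurable_embedding f &
        borel_complete R Gamma (range f)].

Definition bounded_continuous (R : realType) (X : topologicalType)
    : set {ptws X -> R} :=
  [set f : {ptws X -> R} | continuous (f : X -> R) /\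
     exists M : R, forall x, `|f x| <= M].
Arguments bounded_continuous : clear implicits.

(* The coercion of this set to a type carries the subspace topology. *)
Definition bc_fun (R : realType) (X : topologicalType) : Type :=
  bounded_continuous R X.

HB.instance Definition _ (R : realType) (X : topologicalType) :=
  Topological.copy (bc_fun R X) (set_type (bounded_continuous R X)).

Lemma bounded_continuous0 (R : realType) (X : topologicalType) :
  bounded_continuous R X (fun=> 0).
Proof.
split; first by move=> x; exact: cvg_cst.
by exists 0 => x; rewrite normr0.
Qed.

HB.instance Definition _ (R : realType) (X : topologicalType) :=
  isPointed.Build (bc_fun R X) (SigSub (mem_set (bounded_continuous0 R X))).

Definition Cp_star (R : realType) (X : topologicalType) : measurableType _ :=
  borel (bc_fun R X).

(* Main.v *)
(* The Borel structure of C_p^*(X) is generated by the evaluations at a dense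
   sequence d of X, so C_p^*(X) embeds into the space of real sequences; its
   range, the sequences extending to bounded continuous functions, is Pi^1_n
   because "g does not oscillate at x" is Borel in (g, x) and is required for
   all x in the Sigma^1_n set X.

   For hardness, write the complement of a Pi^1_n set B as the set of s with
   (s, c) in A for some c in the Cantor space, A being Pi^1_(n-1).  As X is not
   Sigma^1_(n-1), Wadge's lemma (this is where determinacy enters) gives a
   continuous H into a Polish space containing X with A = H^-1(X).  With the
   compact set K_s = {H(s, c)}, s is in B iff K_s misses X.  It remains to
   attach to K_s, in a Borel way, a bounded function continuous off K_s and
   oscillating along d at every point of K_s in X: a greedy choice yields points
   of d accumulating at all these points and whose distances to K_s decrease
   geometrically; F_s consists of every other one of them, and the function is
   dist(., K_s u F_s) / dist(., K_s), which is 0 on F_s and at least 1/2 at the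
   remaining points. *)

From HB Require Import structures.
Require Import Defs.
From mathcomp Require Import all_boot all_order all_algebra.
From mathcomp Require Import all_classical all_reals all_analysis.
From mathcomp Require Import lra.

Set Implicit Arguments.
Unset Strict Implicit.
Unset Printing Implicit Defensive.

Import Order.TTheory GRing.Theory Num.Theory.
Import numFieldNormedType.Exports.

Local Open Scope classical_set_scope.
Local Open Scope ring_scope.

(** * The Baire space and the projective classes *)

(** Everything is moved to the Baire space, where games are played and where a map is Borel as soon
    as the level sets of its coordinates are. The link is a continuous surjection [p] from the Baire
    space onto a Polish space, with a section [s] whose coordinates have differences of open sets as
    level sets: through [p], a quantifier over the Polish space becomes a projection, and through
    [s], points and sequences of points receive Borel codes.

    The inner quantifier is moved to the Cantor space because K_s has to be closed: the distance to
    K_s is then positive off K_s, and dividing by it preserves continuity at the points of X outside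
    K_s. As K_s is moreover the image of one fixed set, its distance to a given point is upper
    semicontinuous in s, and no finer information on s is required for the construction to be Borel.

    The bound 1/2 comes from the geometric decrease: the distances to K_s of the points reached at
    two different moves differ by a factor of at least 2, and the distance to K_s is 1-Lipschitz, so
    these points lie apart by at least half of the larger distance. *)

Definition npair (a b : nat) : nat := (2 ^ a * b.*2.+1).-1%N.
Definition nleft (n : nat) : nat := logn 2 n.+1.
Definition nright (n : nat) : nat := (n.+1 %/ 2 ^ logn 2 n.+1)./2%N.

Lemma npairS a b : (npair a b).+1 = (2 ^ a * b.*2.+1)%N.
Proof. by rewrite /npair prednK// muln_gt0 expn_gt0. Qed.

Lemma logn_npair a b : logn 2 (npair a b).+1 = a.
Proof.
rewrite npairS lognM ?expn_gt0// pfactorK// lognE /=.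
by rewrite dvdn2 /= odd_double addn0.
Qed.

Lemma nleft_npair a b : nleft (npair a b) = a.
Proof. exact: logn_npair. Qed.

Lemma nright_npair a b : nright (npair a b) = b.
Proof.
by rewrite /nright logn_npair npairS mulKn ?expn_gt0//= uphalf_double.
Qed.

Lemma npair_left_right n : npair (nleft n) (nright n) = n.
Proof.
rewrite /npair /nleft /nright.
have dv : (2 ^ logn 2 n.+1 %| n.+1)%N by exact: pfactor_dvdnn.
set q := (n.+1 %/ _)%N.
have qE : (2 ^ logn 2 n.+1 * q)%N = n.+1 by rewrite mulnC divnK.
have q_odd : odd q.
  have /esym := congr1 (logn 2) qE.
  have q0 : (0 < q)%N by case: q qE => //; rewrite muln0.
  rewrite lognM ?expn_gt0// pfactorK// => /eqP.
  rewrite -{1}[logn 2 n.+1]addn0 eqn_add2l eq_sym lognE q0 /= dvdn2.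
  by case: (odd q).
have -> : q./2.*2.+1 = q by rewrite -[RHS]odd_double_half q_odd.
by rewrite qE.
Qed.

Notation baire := baire_space.

Lemma nbhs_baireP (x : baire) (A : set baire) :
  nbhs x A <->
  exists n, forall y : baire, (forall i, (i < n)%N -> y i = x i) -> A y.
Proof.
(* The filter generated by the cylinders around [x]. The product topology is a supremum of initial
   topologies, so convergence to [x] is tested one coordinate at a time. *)
pose G : set_system baire := [set B | exists n, forall y : baire,
  (forall i, (i < n)%N -> y i = x i) -> B y].
have GF : Filter G.
  split=> /=.
  - by exists 0%N.
  - move=> P Q [n nP] [m mQ]; exists (maxn n m) => y yx; split.
      by apply: nP => i ni; apply: yx; rewrite leq_max ni.
    by apply: mQ => i mi; apply: yx; rewrite leq_max mi orbT.
  - by move=> P Q PQ [n nP]; exists n => y yx; apply/PQ/nP.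
have Gx : G --> x.
  apply/cvg_sup => i B; rewrite nbhsE => -[C [[D _ <-] Dx] CB].
  exists i.+1 => y /(_ i (ltnSn i)) yx; apply: (CB y).
  by have : D (y i) by rewrite yx; exact: Dx.
split; first exact: Gx.
move=> [n nA].
have xi i : nbhs x [set y : baire | y i = x i].
  apply: (@proj_continuous nat (fun=> nat) i x [set x i]).
  exact: discrete_set1.
suff : nbhs x [set y : baire | forall i, (i < n)%N -> y i = x i].
  by apply: filterS => y; exact: nA.
elim: {nA} n => [|n ih]; first exact: filterS filterT.
apply: filterS2 ih (xi n) => y yn ynx i.
by rewrite ltnS leq_eqVlt => /orP[/eqP ->|/yn].
Qed.

Lemma continuous_baireP (T : topologicalType) (f : T -> baire) :
  continuous f <-> forall t n, \forall u \near t, f u n = f t n.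
Proof.
split=> [cf t n|cf t A /nbhs_baireP[n nA]].
  apply: (cf t [set y : baire | y n = f t n]); apply/nbhs_baireP.
  by exists n.+1 => y; apply.
have : \forall u \near t, forall i, (i < n)%N -> f u i = f t i.
  elim: {nA} n => [|n ih]; first exact: filterS filterT.
  apply: filterS2 ih (cf t n) => y yn ynx i.
  by rewrite ltnS leq_eqVlt => /orP[/eqP ->|/yn].
by apply: filterS => u; exact: nA.
Qed.

Lemma near_baire (x : baire) n : \forall y \near x, y n = x n.
Proof. by apply/nbhs_baireP; exists n.+1 => y; apply. Qed.

Lemma near_agree (x : baire) n :
  \forall y \near x, forall i, (i < n)%N -> y i = x i.
Proof. by apply/nbhs_baireP; exists n. Qed.

Lemma continuous_reindex (g : nat -> nat) :
  continuous (fun z : baire => (fun n => z (g n)) : baire).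
Proof. by apply/continuous_baireP => z n; exact: near_baire. Qed.

Definition bfst (z : baire) : baire := fun n => z n.*2.
Definition bsnd (z : baire) : baire := fun n => z n.*2.+1.
Definition bpair (x y : baire) : baire :=
  fun n => if odd n then y n./2 else x n./2.
Definition brow (z : baire) (k : nat) : baire := fun n => z (npair k n).

Lemma bfst_continuous : continuous bfst. Proof. exact: continuous_reindex. Qed.

Lemma bsnd_continuous : continuous bsnd. Proof. exact: continuous_reindex. Qed.

Lemma brow_continuous k : continuous (brow ^~ k).
Proof. exact: continuous_reindex. Qed.

Lemma bfst_bpair x y : bfst (bpair x y) = x.
Proof. by apply/funext => n; rewrite /bfst /bpair odd_double doubleK. Qed.

Lemma bsnd_bpair x y : bsnd (bpair x y) = y.
Proof. by apply/funext => n; rewrite /bsnd /bpair /= odd_double uphalf_double. Qed.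

Lemma brow_npair (z : nat -> baire) k :
  brow (fun n => z (nleft n) (nright n)) k = z k.
Proof. by apply/funext => n; rewrite /brow nleft_npair nright_npair. Qed.

Lemma near_fst (P Q : topologicalType) (S : P -> Prop) (u : P * Q) :
  (\forall p \near u.1, S p) -> \forall v \near u, S v.1.
Proof. by case: u => p q h; exact: (@cvg_fst _ _ (nbhs p) (nbhs q) _ S h). Qed.

Lemma near_snd (P Q : topologicalType) (S : Q -> Prop) (u : P * Q) :
  (\forall p \near u.2, S p) -> \forall v \near u, S v.2.
Proof. by case: u => p q h; exact: (@cvg_snd _ _ (nbhs p) (nbhs q) _ S h). Qed.

Lemma bpair_continuous : continuous (fun u : baire * baire => bpair u.1 u.2).
Proof.
apply/continuous_baireP => u n /=; rewrite /bpair; case: (odd n).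
  exact: (near_snd (S := fun y : baire => y n./2 = u.2 n./2)
    (near_baire u.2 n./2)).
exact: (near_fst (S := fun y : baire => y n./2 = u.1 n./2)
  (near_baire u.1 n./2)).
Qed.

Lemma continuous_compose (T U V : topologicalType) (g : U -> V) (f : T -> U) :
  continuous g -> continuous f -> continuous (fun x => g (f x)).
Proof. by move=> cg cf x; apply: continuous_comp; [exact: cf|exact: cg]. Qed.

Lemma continuous_fst (T U : topologicalType) : continuous (@fst T U).
Proof. by move=> x; exact: cvg_fst. Qed.

Lemma continuous_snd (T U : topologicalType) : continuous (@snd T U).
Proof. by move=> x; exact: cvg_snd. Qed.

Lemma continuous_id (T : topologicalType) : continuous (fun x : T => x).
Proof. by move=> x; exact: cvg_id. Qed.

Lemma continuous_pair (T U V : topologicalType) (f : T -> U) (g : T -> V) :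
  continuous f -> continuous g -> continuous (fun x => (f x, g x)).
Proof. by move=> cf cg x; apply: cvg_pair; [exact: cf|exact: cg]. Qed.

Lemma closed_preimage (T U : topologicalType) (f : T -> U) (C : set U) :
  continuous f -> closed C -> closed (f @^-1` C).
Proof. by move=> cf cC; apply: preimage_closed => // x _; exact: cf. Qed.

Lemma open_preimage (T U : topologicalType) (f : T -> U) (C : set U) :
  continuous f -> open C -> open (f @^-1` C).
Proof. by move=> /continuousP; exact. Qed.

Lemma Sigma1_preimage m (P Q : topologicalType) (f : P -> Q) (A : set Q) :
  continuous f -> Sigma1 m A -> Sigma1 m (f @^-1` A).
Proof.
elim: m P Q f A => [//|m ih] P Q f A cf /= [C hC ->].
have cg : continuous (fun u : P * baire => (f u.1, u.2)).
  apply: continuous_pair; last exact: continuous_snd.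
  by apply: continuous_compose => //; exact: continuous_fst.
exists ((fun u : P * baire => (f u.1, u.2)) @^-1` C).
  case: m ih hC => [_ hC|m ih hC]; first exact: closed_preimage.
  by apply: (ih _ _ _ _ cg hC).
apply/seteqP; split=> [p [[q z] /= Cqz qE]|p [[p' z] /= Cpz <-]].
  by exists (p, z) => //=; rewrite -qE.
by exists (f p', z).
Qed.

(** Gluing along a partition into clopen pieces commutes with complements, unlike a countable union,
    so the induction passes through the alternating levels. Reading the index off a witness then
    yields countable unions. *)
Lemma Sigma1_glue m (P : topologicalType) (k : P -> nat) (B : nat -> set P) :
  (forall p, \forall q \near p, k q = k p) ->
  (forall i, Sigma1 m (B i)) -> Sigma1 m [set p | B (k p) p].
Proof.
elim: m P k B => [|m ih] P k B ck; first by move=> /(_ 0%N).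
move=> /= hB.
have {hB} [C hC] : exists C : nat -> set (P * baire), forall i,
    (if m is 0 then closed (C i) else Sigma1 m (~` C i)) /\ B i = fst @` C i.
  have : forall i, exists C : set (P * baire),
      (if m is 0 then closed C else Sigma1 m (~` C)) /\ B i = fst @` C.
    by move=> i; have [C h1 h2] := hB i; exists C.
  by move=> /choice[C hC]; exists C.
have ck' (u : P * baire) : \forall v \near u, k v.1 = k u.1.
  exact: (near_fst (S := fun p => k p = k u.1) (ck u.1)).
exists [set u : P * baire | C (k u.1) u].
  case: m ih hC => [_ hC|m ih hC]; last first.
    have := ih _ (fun u : P * baire => k u.1) (fun i => ~` C i) ck'.
    by apply=> i; have [] := hC i.
  rewrite -[X in closed X]setCK; apply: open_closedC.
  rewrite openE => u /= Cu.
  have oC : open (~` C (k u.1)).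
    by apply: closed_openC; have [] := hC (k u.1).
  have : nbhs u (~` C (k u.1)) by exact: open_nbhs_nbhs.
  rewrite /interior; move: (ck' u); apply: filterS2 => v /= ->; exact.
apply/seteqP; split=> [p /=|p [[p' z] /= Cpz <-]].
  have [_ {1}->] := hC (k p); move=> [[q z] /= Cqz qE]; subst q.
  by exists (p, z).
by have [_ ->] := hC (k p'); exists (p', z).
Qed.

(** Two successive witnesses in the Baire space are merged into a single one by the pairing
    [bpair]. *)
Lemma Sigma1_proj m (P : topologicalType) (A : set (P * baire)) :
  Sigma1 m A -> Sigma1 m (fst @` A).
Proof.
case: m => [//|m] /= [C hC ->].
pose f (u : P * baire) := ((u.1, bfst u.2), bsnd u.2).
have cf : continuous f.
  apply: continuous_pair; last first.
    by apply: continuous_compose; [exact: bsnd_continuous|exact: continuous_snd].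
  apply: continuous_pair; first exact: continuous_fst.
  by apply: continuous_compose; [exact: bfst_continuous|exact: continuous_snd].
exists (f @^-1` C).
  case: m hC => [|m] hC; first exact: closed_preimage.
  exact: Sigma1_preimage cf hC.
apply/seteqP; split=> [p [[p' z] [[[p'' z'] z''] /= Cz [pE zE] <-]]|].
  subst p'' z'.
  exists (p', bpair z z''); last by [].
  by rewrite /preimage /f /= bfst_bpair bsnd_bpair.
move=> p [[p' z] /= Cz <-]; exists (p', bfst z) => //.
by exists (f (p', z)).
Qed.

Lemma Sigma1_bigcup m (P : topologicalType) (A : nat -> set P) :
  (forall i, Sigma1 m (A i)) -> Sigma1 m (\bigcup_i A i).
Proof.
move=> hA.
have -> : \bigcup_i A i = fst @` [set u : P * baire | A (u.2 0%N) u.1].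
  apply/seteqP; split=> [p [i _ Aip]|p [[p' z] /= Apz <-]].
    by exists (p, fun=> i).
  by exists (z 0%N).
apply: Sigma1_proj.
apply: (@Sigma1_glue _ _ (fun u : P * baire => u.2 0%N)
  (fun i => fst @^-1` A i)) => [u|i].
  exact: (near_snd (S := fun z : baire => z 0%N = u.2 0%N) (near_baire _ _)).
by apply: Sigma1_preimage => //; exact: continuous_fst.
Qed.

(** The witnesses for all indices are stored as the rows of a single one. At the level below, the
    complement of the resulting intersection is a union, which is left to [Sigma1_bigcup]. *)
Lemma Sigma1_bigcap m (P : topologicalType) (A : nat -> set P) :
  (forall i, Sigma1 m (A i)) -> Sigma1 m (\bigcap_i A i).
Proof.
case: m => [/(_ 0%N)//|m] /= hA.
have {hA} [C hC] : exists C : nat -> set (P * baire), forall i,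
    (if m is 0 then closed (C i) else Sigma1 m (~` C i)) /\ A i = fst @` C i.
  have : forall i, exists C : set (P * baire),
      (if m is 0 then closed C else Sigma1 m (~` C)) /\ A i = fst @` C.
    by move=> i; have [C h1 h2] := hA i; exists C.
  by move=> /choice[C hC]; exists C.
pose f k (u : P * baire) := (u.1, brow u.2 k).
have cf k : continuous (f k).
  apply: continuous_pair; first exact: continuous_fst.
  exact: (continuous_compose (@brow_continuous k) (@continuous_snd P baire)).
exists (\bigcap_k (f k @^-1` C k)).
  case: m hC => [|m] hC.
    apply: (@closed_bigI _ _ setT (fun k => f k @^-1` C k)) => i _.
    by apply: closed_preimage (cf i) _; have [] := hC i.
  rewrite setC_bigcap; apply: Sigma1_bigcup => i.
  by rewrite preimage_setC; apply: Sigma1_preimage => //; have [] := hC i.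
apply/seteqP; split=> [p Ap|p [[p' z] /= Cz <-] i _]; last first.
  by have [_ ->] := hC i; exists (f i (p', z)) => //; exact: Cz.
have /choice[z hz] : forall i, exists z, C i (p, z).
  move=> i; have := Ap i I; have [_ ->] := hC i.
  by move=> [[p' z] Cz /= <-]; exists z.
exists (p, (fun n => z (nleft n) (nright n)) : baire) => //= i _.
by rewrite /f /= brow_npair.
Qed.

Lemma Sigma1_setU m (P : topologicalType) (A B : set P) :
  Sigma1 m A -> Sigma1 m B -> Sigma1 m (A `|` B).
Proof.
move=> hA hB.
rewrite (_ : A `|` B = \bigcup_i (if i is 0%N then A else B)).
  by apply: Sigma1_bigcup => -[].
apply/seteqP; split=> [p [h|h]|p [[|i] _ h]];
  by [exists 0%N|exists 1%N|left|right].
Qed.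

Lemma Sigma1_setI m (P : topologicalType) (A B : set P) :
  Sigma1 m A -> Sigma1 m B -> Sigma1 m (A `&` B).
Proof.
move=> hA hB.
rewrite (_ : A `&` B = \bigcap_i (if i is 0%N then A else B)).
  by apply: Sigma1_bigcap => -[].
apply/seteqP; split=> [p [h h'] [|i]//|p h].
by split; [exact: (h 0%N)|exact: (h 1%N)].
Qed.

(* Stated for [P * baire] instead of [P] so as to pass to further products with
   the Baire space. *)
Definition open_fsigma (P : topologicalType) : Prop :=
  forall O : set (P * baire), open O ->
  exists2 F : nat -> set (P * baire),
    forall k, closed (F k) & O = \bigcup_k F k.

Lemma open_fsigma_prod (P : topologicalType) :
  open_fsigma P -> open_fsigma (P * baire)%type.
Proof.
move=> hP O oO.
pose f (u : P * baire) := ((u.1, bfst u.2), bsnd u.2).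
have cf : continuous f.
  apply: continuous_pair; last first.
    by apply: continuous_compose; [exact: bsnd_continuous|exact: continuous_snd].
  apply: continuous_pair; first exact: continuous_fst.
  by apply: continuous_compose; [exact: bfst_continuous|exact: continuous_snd].
pose g (u : P * baire * baire) := (u.1.1, bpair u.1.2 u.2).
have cg : continuous g.
  apply: continuous_pair; first by apply: continuous_compose; exact: continuous_fst.
  apply: (@continuous_compose _ _ _ _ (fun u : P * baire * baire => (u.1.2, u.2))
    bpair_continuous).
  apply: continuous_pair; last exact: continuous_snd.
  by apply: continuous_compose; [exact: continuous_snd|exact: continuous_fst].
have gK u : f (g u) = u.
  by case: u => -[p z] z'; rewrite /f /g /= bfst_bpair bsnd_bpair.
have [F cF FE] := hP _ (open_preimage cf oO).
exists (fun k => g @^-1` F k) => [k|]; first exact: closed_preimage.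
by rewrite -preimage_bigcup -FE; apply/seteqP; split=> u /=; rewrite gK.
Qed.

(** Closed and open sets exchange roles under the complement taken at each level, so both are
    treated together. At level 1 an open set is a countable union of closed sets, hence again a
    projection of a closed set. *)
Lemma Sigma1_closed_open m (P : topologicalType) : open_fsigma P ->
  (forall C : set P, closed C -> Sigma1 m.+1 C) /\
  (forall O : set P, open O -> Sigma1 m.+1 O).
Proof.
have clos1 (Q : topologicalType) (C : set Q) : closed C -> Sigma1 1 C.
  move=> cC; exists (fst @^-1` C).
    by apply: closed_preimage => //; exact: continuous_fst.
  apply/seteqP; split=> [p Cp|p [[q z] /= Cq <-]//].
  by exists (p, point).
have fstE (A : set P) : A = fst @` ((fst : P * baire -> P) @^-1` A).
  apply/seteqP; split=> [p Cp|p [[q z] /= Cq <-]//].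
  by exists (p, point).
elim: m P fstE => [|m ih] P fstE hP.
  split; first exact: clos1.
  move=> O oO; rewrite (fstE O).
  have [F cF ->] := hP _ (open_preimage (@continuous_fst P baire) oO).
  by apply: Sigma1_proj; apply: Sigma1_bigcup => i; exact: clos1.
have fstE' (A : set (P * baire)) :
    A = fst @` ((fst : P * baire * baire -> P * baire) @^-1` A).
  apply/seteqP; split=> [p Cp|p [[q z] /= Cq <-]//].
  by exists (p, point).
have [cl op] := ih _ fstE' (open_fsigma_prod hP).
split=> [C cC|O oO].
  exists (fst @^-1` C) => //; apply: op; rewrite preimage_setC.
  by apply: open_preimage (@continuous_fst P baire) _; exact: closed_openC.
exists (fst @^-1` O) => //; apply: cl; rewrite preimage_setC.
by apply: closed_preimage (@continuous_fst P baire) _; exact: open_closedC.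
Qed.

Lemma Sigma1_succ m (P : topologicalType) (A : set P) : open_fsigma P ->
  Sigma1 m A -> Sigma1 m.+1 A.
Proof.
elim: m P A => [//|m ih] P A hP [C hC ->]; exists C => //.
case: m ih hC => [_ hC|m ih hC]; last exact: ih (open_fsigma_prod hP) _.
have [_ op] := Sigma1_closed_open 0 (open_fsigma_prod hP).
by apply: op; exact: closed_openC.
Qed.

Lemma Pi1_Sigma1_succ m (P : topologicalType) (A : set P) :
  (0 < m)%N -> Pi1 m A -> Sigma1 m.+1 A.
Proof.
case: m => // m _ hA; exists (fst @^-1` A).
  by rewrite preimage_setC; apply: Sigma1_preimage hA; exact: continuous_fst.
apply/seteqP; split=> [p Cp|p [[q z] /= Cq <-]//].
by exists (p, point).
Qed.

(** * Metric spaces *)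

Lemma exists_invX2_lt (R : realType) (e : R) : 0 < e ->
  exists n, ((2 ^+ n)^-1 : R) < e.
Proof.
move=> e0; have [N _ hN] := near_infty_natSinv_expn_lt (PosNum e0).
by exists N; have /= := hN N (leqnn N); rewrite div1r.
Qed.

Lemma invX2_gt0 (R : realType) n : 0 < (2 ^+ n)^-1 :> R.
Proof. by rewrite invr_gt0 exprn_gt0. Qed.

Lemma invX2S (R : realType) n : (2 ^+ n.+1)^-1 = (2 ^+ n)^-1 / 2 :> R.
Proof. by rewrite exprS invfM mulrC. Qed.

Lemma invX2_le (R : realType) m n : (m <= n)%N ->
  (2 ^+ n)^-1 <= (2 ^+ m)^-1 :> R.
Proof.
move=> mn; rewrite lef_pV2 ?posrE ?exprn_gt0//.
by apply: ler_weXn2l => //; rewrite ler1n.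
Qed.

Lemma nbhs_mdist_exP (R : realType) (M : metricType R) (x : M) (A : set M) :
  nbhs x A <-> exists2 e : R, 0 < e & forall y, mdist x y < e -> A y.
Proof.
rewrite -metricType_numDomainType.filter_from_mdist_nbhs; split=> -[e e0 he]; exists e => //.
Qed.

Lemma near_mdist_lt (R : realType) (M : metricType R) (x y : M) (r : R) :
  mdist x y < r -> \forall z \near x, mdist z y < r.
Proof.
move=> xyr; apply/nbhs_mdist_exP; exists (r - mdist x y); rewrite ?subr_gt0//.
move=> z; rewrite ltrBrDr => h; apply: le_lt_trans h.
by rewrite metric_sym [mdist x z]metric_sym -metric_sym metric_triangle.
Qed.

Lemma open_mdist_lt (R : realType) (M : metricType R) (y : M) (r : R) :
  open [set x | mdist x y < r].
Proof. by rewrite openE => x; exact: near_mdist_lt. Qed.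

Lemma metric_open_fsigma (R : realType) (M : metricType R) : open_fsigma M.
Proof.
move=> O oO.
(* [F k] collects the points whose basic neighbourhood of size [k] lies in [O]. It is closed: a
   point [v] outside [O] in that neighbourhood of [u] also lies in the ones of all points near
   [u]. *)
pose F k := [set u : M * baire | forall v : M * baire,
  mdist u.1 v.1 < (2 ^+ k)^-1 -> (forall i, (i < k)%N -> u.2 i = v.2 i) -> O v].
exists F => [k|].
  rewrite -[X in closed X]setCK; apply: open_closedC; rewrite openE.
  move=> u /existsNP[v /not_implyP[uv1 /not_implyP[uv2 Ov]]].
  have n1 : \forall w \near u, mdist w.1 v.1 < (2 ^+ k)^-1.
    exact: (near_fst (S := fun x => mdist x v.1 < (2 ^+ k)^-1) (near_mdist_lt uv1)).
  have n2 : \forall w \near u, forall i, (i < k)%N -> w.2 i = u.2 i.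
    exact: (near_snd (S := fun x : baire => forall i, (i < k)%N -> x i = u.2 i)
      (near_agree u.2 k)).
  rewrite /interior; apply: filterS2 n1 n2 => w w1 w2 /(_ v w1) Fw.
  by apply: Ov; apply: Fw => i ik; rewrite w2// uv2.
apply/seteqP; split=> [u Ou|u [k _]]; last by apply; rewrite ?mdistxx ?invX2_gt0.
have : nbhs u O by exact: open_nbhs_nbhs.
case: u Ou => x z Ou [[A B] /= [/nbhs_mdist_exP[e e0 eA] /nbhs_baireP[n nB]] AB].
have [m me] := exists_invX2_lt e0.
exists (maxn m n) => // -[x' z'] /= xx' zz'; apply: AB; split=> /=.
  apply: eA; apply: (lt_trans (lt_le_trans xx' _) me).
  by apply: invX2_le; rewrite leq_max leqnn.
by apply: nB => i ni; rewrite zz'// leq_max ni orbT.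
Qed.

Lemma open_fsigma_homeo (P Q : topologicalType) (h : P -> Q) :
  homeomorphism h -> open_fsigma Q -> open_fsigma P.
Proof.
move=> [ch [g cg [hK gK]]] hQ O oO.
pose h' (u : P * baire) := (h u.1, u.2).
pose g' (u : Q * baire) := (g u.1, u.2).
have ch' : continuous h'.
  apply: continuous_pair; last exact: continuous_snd.
  exact: (continuous_compose ch (@continuous_fst P baire)).
have cg' : continuous g'.
  apply: continuous_pair; last exact: continuous_snd.
  exact: (continuous_compose cg (@continuous_fst Q baire)).
have [F cF FE] := hQ _ (open_preimage cg' oO).
exists (fun k => h' @^-1` F k) => [k|]; first exact: closed_preimage.
rewrite -preimage_bigcup -FE; apply/seteqP; split=> -[u z];
  by rewrite /preimage /h' /g' /= hK.
Qed.

(** * A complete metric on the Baire space *)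

Definition bdiff (x y : baire) : nat :=
  xget 0%N [set k | x k <> y k /\ forall i, (i < k)%N -> x i = y i].

Lemma bdiffP (x y : baire) : x <> y ->
  x (bdiff x y) <> y (bdiff x y) /\ forall i, (i < bdiff x y)%N -> x i = y i.
Proof.
move=> xy; rewrite /bdiff; case: xgetP => [k _ []//|h]; exfalso.
have [k hk] : exists k, x k != y k.
  by apply: contrapT => /forallNP h'; apply: xy; apply/funext => k;
    apply: contrapT => /eqP; exact: h'.
have exk : exists k, x k != y k by exists k.
case: (ex_minnP exk) => j jxy jmin; apply: (h j); split; first exact/eqP.
move=> i ij; apply: contrapT => /eqP /jmin; by rewrite leqNgt ij.
Qed.

Definition bdist (R : realType) (x y : baire) : R :=
  if `[< x = y >] then 0 else (2 ^+ bdiff x y)^-1.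

Lemma bdist_eq0 (R : realType) (x : baire) : bdist R x x = 0.
Proof. by rewrite /bdist; case: asboolP. Qed.

Lemma bdist_ge0 (R : realType) (x y : baire) : 0 <= bdist R x y.
Proof. by rewrite /bdist; case: asboolP => // _; rewrite ltW// invX2_gt0. Qed.

Lemma bdist_ge (R : realType) (x y : baire) k : x k <> y k -> (2 ^+ k)^-1 <= bdist R x y.
Proof.
move=> xyk; rewrite /bdist; case: asboolP => [xy|/bdiffP[h1 h2]].
  by rewrite xy in xyk.
apply: invX2_le; rewrite leqNgt; apply/negP => /h2; exact: xyk.
Qed.

Lemma bdist_le (R : realType) (x y : baire) k : (forall i, (i < k)%N -> x i = y i) ->
  bdist R x y <= (2 ^+ k)^-1.
Proof.
move=> h; rewrite /bdist; case: asboolP => [xy|/bdiffP[h1 h2]].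
  by rewrite ltW// invX2_gt0.
apply: invX2_le; rewrite leqNgt; apply/negP => /h; exact: h1.
Qed.

Lemma bdist_positivity (R : realType) (x y : baire) : bdist R x y = 0 -> x = y.
Proof.
rewrite /bdist; case: asboolP => // _ /eqP.
by rewrite gt_eqF// invX2_gt0.
Qed.

Lemma bdist_sym (R : realType) (x y : baire) : bdist R x y = bdist R y x.
Proof.
have le u v : bdist R u v <= bdist R v u.
  rewrite {1}/bdist; case: asboolP => [_|/bdiffP[h _]]; first exact: bdist_ge0.
  by apply: bdist_ge => /esym.
by apply/eqP; rewrite eq_le !le.
Qed.

Lemma bdist_triangle (R : realType) (y x z : baire) : bdist R x z <= bdist R x y + bdist R y z.
Proof.
rewrite {1}/bdist; case: asboolP => [_|/bdiffP[h _]].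
  by rewrite addr_ge0// bdist_ge0.
set k := bdiff x z in h *.
have [xy|xy] := eqVneq (x k) (y k).
  rewrite -[X in X <= _]add0r lerD ?bdist_ge0// bdist_ge//.
  by rewrite -xy.
rewrite -[X in X <= _]addr0 lerD ?bdist_ge0// bdist_ge//.
exact/eqP.
Qed.

(** A copy of the type, so that the topology of [bdist] and the product topology are carried by
    different names and can be compared by a homeomorphism. *)
Definition baire_metric (R : realType) : Type := baire.
HB.instance Definition _ (R : realType) := Choice.on (baire_metric R).
HB.instance Definition _ (R : realType) :=
  @isMetric.Build R (baire_metric R) (@bdist R) (@bdist_eq0 R)
    (@bdist_positivity R) (@bdist_sym R) (@bdist_triangle R).

Lemma baire_metric_homeo (R : realType) :
  homeomorphism (id : baire -> baire_metric R).
Proof.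
split; last (exists id; last by []).
  move=> x A /nbhs_mdist_exP[e e0 eA]; apply/nbhs_baireP.
  have [n ne] := exists_invX2_lt e0; exists n => y xy; apply: eA.
  by apply: le_lt_trans ne; apply: bdist_le => i ik; rewrite xy.
move=> x A /nbhs_baireP[n nA]; apply/nbhs_mdist_exP.
exists (2 ^+ n)^-1; first exact: invX2_gt0.
move=> y xy; apply: nA => i ni; apply: contrapT => yx.
have := @bdist_ge R y x i yx; rewrite leNgt => /negP; apply.
rewrite bdist_sym; apply: lt_le_trans xy _; apply: invX2_le; exact: ltnW.
Qed.

Lemma baire_open_fsigma (R : realType) : open_fsigma baire.
Proof.
by apply: open_fsigma_homeo (baire_metric_homeo R) _; exact: metric_open_fsigma.
Qed.

Lemma baire_metric_complete (R : realType) : metric_complete (baire_metric R).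
Proof.
move=> F FF /cauchy_ballP cF.
have hx n : exists x : baire, F [set y : baire | forall i, (i <= n)%N -> y i = x i].
  have := @cF _ (invX2_gt0 R n) => -[[A B] [FA FB] AB].
  have [x Ax] := filter_ex FA.
  exists x; apply: filterS FB => y By i lin; apply: contrapT => xy.
  have := AB (x, y) (conj Ax By); rewrite /= ballEmdist /=.
  apply/negP; rewrite -leNgt metric_sym.
  by apply: le_trans (@bdist_ge R y x i xy); exact: invX2_le.
have [X hX] := choice hx.
(* The diagonal: [X n] is correct up to index [n] inclusive, so its term of index [n] is that of the
   limit. *)
exists (fun n => X n n) => A /nbhs_mdist_exP[e e0 eA].
have [n ne] := exists_invX2_lt e0.
have : F [set y : baire | forall i, (i < n)%N -> y i = X i i].
  elim: {ne} n => [|n ih]; first exact: filterS filterT.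
  apply: filterS2 ih (hX n) => y yn ynx i.
  by rewrite ltnS leq_eqVlt => /orP[/eqP ->|/yn//]; exact: ynx.
apply: filterS => y yX; apply: eA; apply: le_lt_trans ne.
by apply: bdist_le => i ik; rewrite yX.
Qed.

Lemma countable_ne_enum (T : Type) (D : set T) : countable D -> D !=set0 ->
  exists q : nat -> T, range q = D.
Proof.
move=> /countable_injP[f finj] [d Dd].
have /choice[q hq] : forall n, exists x,
    D x /\ forall y, D y -> f y = n -> x = y.
  move=> n; have [[x [Dx xn]]|h] := pselect (exists x, D x /\ f x = n).
    by exists x; split=> // y Dy yn; apply: finj; rewrite ?inE// xn.
  by exists d; split=> // y Dy yn; exfalso; apply: h; exists y.
exists q; apply/seteqP; split=> [x [n _ <-]|x Dx]; first by have [] := hq n.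
by exists (f x) => //; have [_] := hq (f x); exact.
Qed.

Lemma baire_polish (R : realType) : polish R baire.
Proof.
split; last first.
  exists (baire_metric R), id; split; first exact: baire_metric_complete.
  exact: baire_metric_homeo.
pose f (s : seq nat) : baire := fun n => nth 0%N s n.
exists (range f).
  apply: card_le_trans (card_image_le _ _) _; exact: countableP.
move=> O [x Ox] oO.
have /nbhs_baireP[n nO] : nbhs x O by exact: open_nbhs_nbhs.
exists (f (mkseq x n)); split; last by exists (mkseq x n).
by apply: nO => i ni; rewrite /f nth_mkseq.
Qed.

(** * Parametrization of Polish spaces and Wadge's lemma *)

(* The limit of the points [q (z k)], those too far from the preceding one being
   skipped so that every [z] gives a Cauchy sequence. *)
Fixpoint approx (R : realType) (M : metricType R) (q : nat -> M) (z : baire)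
    (k : nat) : M :=
  if k is j.+1 then
    if mdist (approx q z j) (q (z k)) <= 2 * (2 ^+ j)^-1 then q (z k)
    else approx q z j
  else q (z 0%N).

Lemma approx_step (R : realType) (M : metricType R) (q : nat -> M) z k :
  mdist (approx q z k) (approx q z k.+1) <= 2 * (2 ^+ k)^-1.
Proof.
by rewrite /=; case: ifP => // _; rewrite mdistxx mulr_ge0// ltW// invX2_gt0.
Qed.

(** The steps 2 * 2^-i form a geometric series of sum 4 * 2^-k. Keeping the subtracted tail lets the
    induction close and later makes the bound 4 * 2^-k strict. *)
Lemma approx_dist (R : realType) (M : metricType R) (q : nat -> M) z k j :
  mdist (approx q z k) (approx q z (k + j)) <= 4 * (2 ^+ k)^-1 - 4 * (2 ^+ (k + j))^-1.
Proof.
elim: j => [|j ih]; first by rewrite addn0 mdistxx subrr.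
apply: le_trans (metric_triangle _ (approx q z (k + j)) _) _.
rewrite addnS; apply: le_trans (lerD ih (approx_step _ _ _)) _.
by rewrite invX2S; lra.
Qed.

Lemma approx_local (R : realType) (M : metricType R) (q : nat -> M) (z z' : baire) k :
  (forall i, (i <= k)%N -> z i = z' i) -> approx q z k = approx q z' k.
Proof.
elim: k => [|k ih] h /=; first by rewrite h.
by rewrite ih ?h// => i ik; apply: h; exact: leq_trans ik _.
Qed.

Lemma approx_limit (R : realType) (M : metricType R) (q : nat -> M) :
  metric_complete M -> exists p : baire -> M,
    forall z k, mdist (approx q z k) (p z) <= 4 * (2 ^+ k)^-1.
Proof.
move=> cM.
suff /choice[p hp] : forall z : baire, exists x : M,
    forall k, mdist (approx q z k) x <= 4 * (2 ^+ k)^-1 by exists p.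
move=> z; have bnd k j : (k <= j)%N ->
    mdist (approx q z k) (approx q z j) < 4 * (2 ^+ k)^-1.
  move=> kj; rewrite -(subnKC kj); apply: le_lt_trans (approx_dist _ _ _ _) _.
  by rewrite ltrBlDr ltrDl mulr_gt0// invX2_gt0.
have [x hx] : exists x : M, approx q z @ \oo --> x.
  apply: cM; apply/cauchy_exP => e e0.
  have [n ne] := @exists_invX2_lt R (e / 4) ltac:(by rewrite divr_gt0).
  exists (approx q z n), n => // j /= nj.
  rewrite ballEmdist /=; apply: lt_trans (bnd _ _ nj) _.
  by rewrite mulrC -ltr_pdivlMr.
exists x => k; apply/ler_addgt0Pr => e e0.
have := hx _ (open_nbhs_nbhs (conj (open_mdist_lt x e) _)).
rewrite /= mdistxx => /(_ e0)[n _ hn].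
apply: le_trans (metric_triangle _ (approx q z (maxn n k)) _) _.
apply: lerD; first by apply/ltW/bnd; exact: leq_maxr.
by apply: ltW; apply: hn; rewrite /= leq_maxl.
Qed.

(** [p z] is the limit of the approximations along [z], and [s x k] is the least index of a point of
    [q] within 2^-k of [x]. Consecutive points chosen by [s x] are less than 3/2 * 2^-k apart, so
    none of them is skipped and the limit is [x]. Taking the least index makes each level set of a
    coordinate an open ball minus a finite union of open balls. *)
Lemma polish_param (R : realType) (M : metricType R) (q : nat -> M) :
  metric_complete M -> dense (range q) ->
  exists (p : baire -> M) (s : M -> baire),
    [/\ continuous p, forall x, p (s x) = x &
      forall k i, exists O1 O2 : set M,
        [/\ open O1, open O2 & [set x | s x k = i] = O1 `\` O2]].
Proof.
move=> cM dq; have [p hp] := approx_limit q cM.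
have near_q x k : exists i, mdist x (q i) < (2 ^+ k)^-1.
  have [|y [xy [i _ iE]]] :=
      dq [set y | mdist y x < (2 ^+ k)^-1] _ (open_mdist_lt _ _).
    by exists x => /=; rewrite mdistxx invX2_gt0.
  by exists i; rewrite iE metric_sym.
pose s x : baire := fun k => ex_minn (near_q x k).
have s_near x k : mdist x (q (s x k)) < (2 ^+ k)^-1.
  by rewrite /s; case: ex_minnP.
exists p, s; split.
- move=> z A /nbhs_mdist_exP[e e0 eA].
  (* Both limits are within 4 * 2^-n of the approximation shared by [z] and [z'], whence 8. *)
  have [n ne] := @exists_invX2_lt R (e / 8) ltac:(by rewrite divr_gt0).
  rewrite nbhs_simpl; apply: filterS (near_agree z n.+1) => z' zz'; apply: eA.
  apply: (@le_lt_trans _ _ (8 * (2 ^+ n)^-1)); last first.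
    by rewrite mulrC -ltr_pdivlMr.
  apply: le_trans (metric_triangle _ (approx q z n) _) _.
  have h1 := hp z n; have h2 := hp z' n.
  rewrite (@approx_local R M q z' z n) in h2; last by move=> i /zz'.
  by rewrite metric_sym; lra.
- move=> x; have ha k : approx q (s x) k = q (s x k).
    elim: k => [//|k ih] /=; rewrite ih ifT//.
    apply: le_trans (metric_triangle _ x _) _.
    have h1 := s_near x k; have h2 := s_near x k.+1.
    rewrite invX2S in h2; rewrite metric_sym.
    by have := invX2_gt0 R k; lra.
  apply/esym/mdist_positivity/eqP; rewrite eq_le mdist_ge0 andbT.
  apply/ler_addgt0Pl => e e0; rewrite addr0.
  (* 4 for the distance from the approximation to the limit, 1 for the distance from [q (s x n)] to
     [x]. *)
  have [n ne] := @exists_invX2_lt R (e / 5) ltac:(by rewrite divr_gt0).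
  apply: le_trans (metric_triangle _ (approx q (s x) n) _) _.
  have h1 := hp (s x) n; have h2 := s_near x n; rewrite ha in h1 *.
  lra.
- move=> k i; exists [set x | mdist x (q i) < (2 ^+ k)^-1].
  exists (\bigcup_(j in [set j | (j < i)%N]) [set x | mdist x (q j) < (2 ^+ k)^-1]).
  split; first exact: open_mdist_lt.
    by apply: bigcup_open => j _; exact: open_mdist_lt.
  apply/seteqP; split=> [x /= <-|x [xi xj]] /=.
    split=> // -[j /=]; rewrite /s; case: ex_minnP => m _ hm jm /hm.
    by rewrite leqNgt jm.
  rewrite /s; case: ex_minnP => m xm hm; apply/eqP; rewrite eqn_leq hm//=.
  by rewrite leqNgt; apply/negP => mi; apply: xj; exists m.
Qed.

(* The play in which the moves at positions of parity [b] are given by the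
   strategy [s] and the others are read off [x]. *)
Fixpoint play_prefix (s : seq nat -> nat) (b : bool) (x : baire) (n : nat) : seq nat :=
  if n is m.+1 then
    let l := play_prefix s b x m in
    rcons l (if odd m == b then s l else x m./2)
  else [::].

Definition play (s : seq nat -> nat) (b : bool) (x : baire) : baire :=
  fun n => last 0%N (play_prefix s b x n.+1).

Lemma play_prefixE s b x n : play_prefix s b x n = mkseq (play s b x) n.
Proof.
elim: n => [//|n ih]; rewrite -addn1 /mkseq iotaD map_cat -/(mkseq _ _) -ih /=.
by rewrite addn1 cats1 /play /= last_rcons.
Qed.

Lemma playE s b x n : play s b x n =
  if odd n == b then s (mkseq (play s b x) n) else x n./2.
Proof. by rewrite {1}/play /= last_rcons play_prefixE. Qed.

Lemma play_continuous s b : continuous (play s b).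
Proof.
apply/continuous_baireP => x n; apply: filterS (near_agree x n.+1) => y yx.
suff H m : (m <= n.+1)%N -> play_prefix s b y m = play_prefix s b x m.
  by rewrite /play H.
elim: m => [//|m ih] mn /=; rewrite ih; last exact: ltnW.
rewrite yx//; apply: leq_trans mn; rewrite ltnS.
by rewrite -[leqRHS]odd_double_half -addnn addnA leq_addl.
Qed.

(** The payoff set of the Wadge game: player I builds [bfst w], player II builds [bsnd w], and I
    wins iff exactly one of [A (bfst w)] and [B (bsnd w)] holds. *)
Lemma Sigma1_nequiv_pair m (A B : set baire) :
  Sigma1 m A -> Pi1 m A -> Sigma1 m B -> Pi1 m B ->
  Sigma1 m [set w | ~ (A (bfst w) <-> B (bsnd w))].
Proof.
move=> sA pA sB pB.
rewrite (_ : [set w | _] = ((bfst @^-1` A) `&` (bsnd @^-1` ~` B)) `|`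
    ((bfst @^-1` ~` A) `&` (bsnd @^-1` B))).
  by apply: Sigma1_setU; apply: Sigma1_setI; apply: Sigma1_preimage => //;
    [exact: bfst_continuous|exact: bsnd_continuous|
     exact: bfst_continuous|exact: bsnd_continuous].
apply/seteqP; split=> w /=; last by tauto.
by have := EM (A (bfst w)); have := EM (B (bsnd w)); tauto.
Qed.

Lemma Sigma1_le (R : realType) m n (A : set baire) :
  (m <= n)%N -> Sigma1 m A -> Sigma1 n A.
Proof.
move=> /subnKC <-; elim: (n - m)%N => [|k ih]; first by rewrite addn0.
by move=> /ih; rewrite addnS; apply: Sigma1_succ; exact: (baire_open_fsigma R).
Qed.

(** In the Wadge game, a winning strategy of player II turns the moves of I continuously into a
    reduction of [A] to [B]. A winning strategy of player I would reduce [B] to the complement of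
    [A], which is [Sigma1 m], against the hypothesis on [B]. *)
Lemma wadge_reduction (R : realType) m n (A B : set baire) :
  projective_determinacy -> (0 < m)%N -> (0 < n)%N ->
  Pi1 m A -> Sigma1 n B -> ~ Sigma1 m B ->
  exists2 h : baire -> baire, continuous h & A = h @^-1` B.
Proof.
move=> pd m0 n0 pA sB nB.
have bf := baire_open_fsigma R.
(* One level above both classes, so that [A], [B] and their complements all belong to [Sigma1 k], as
   does the payoff set. *)
pose k := (maxn m n).+1.
have lift i (C : set baire) : (0 < i)%N -> (i <= maxn m n)%N ->
    Sigma1 i C -> Sigma1 k C /\ Pi1 k C.
  move=> i0 ik sC; split; first by apply: (Sigma1_le R _ sC); exact: leqW.
  apply: (@Sigma1_le R i.+1) => //.
  by apply: Pi1_Sigma1_succ => //; rewrite /Pi1 setCK.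
have [sA' pA'] := lift _ _ m0 (leq_maxl m n) pA.
rewrite /Pi1 setCK in pA'.
have [sB' pB'] := lift _ _ n0 (leq_maxr m n) sB.
have sW := Sigma1_nequiv_pair pA' sA' sB' pB'.
have [[s hs]|[s hs]] := pd _ (ex_intro2 _ _ k isT sW).
- exfalso; apply: nB.
  rewrite (_ : B = (fun y => bfst (play s false y)) @^-1` (~` A)).
    apply: Sigma1_preimage pA.
    exact: (continuous_compose bfst_continuous (@play_continuous s false)).
  apply/seteqP; split=> y.
    move=> By Ay; apply: (hs (play s false y)).
      by move=> j; rewrite playE odd_double.
    rewrite (_ : bsnd _ = y) //.
    by apply/funext => j; rewrite /bsnd playE /= odd_double uphalf_double.
  move=> nA; apply: contrapT => nBy; apply: (hs (play s false y)).
    by move=> j; rewrite playE odd_double.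
  rewrite (_ : bsnd _ = y) //.
  by apply/funext => j; rewrite /bsnd playE /= odd_double uphalf_double.
- exists (fun x => bsnd (play s true x)).
    exact: (continuous_compose bsnd_continuous (@play_continuous s true)).
  apply/seteqP.
  have E x : A x <-> B (bsnd (play s true x)).
    apply: contrapT => h; apply: (hs (play s true x)).
      by move=> j; rewrite playE /= odd_double.
    move: h; rewrite /= (_ : bfst _ = x) //.
    by apply/funext => j; rewrite /bfst playE odd_double doubleK.
  by split=> x /E.
Qed.

(** * Extendability from a dense sequence *)

Definition qseq (R : realType) (n : nat) : R :=
  if @unpickle rat n is Some q then ratr q else 0.

Lemma qseq_itv (R : realType) (x y : R) : x < y -> exists n, x < qseq R n < y.
Proof.
move=> /rat_in_itvoo[q]; rewrite in_itv /= => xqy.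
by exists (pickle q); rewrite /qseq pickleK.
Qed.

Lemma real_param (R : realType) : exists (p : baire -> R) (s : R -> baire),
    [/\ continuous p, forall x, p (s x) = x &
      forall k i, exists O1 O2 : set R,
        [/\ open O1, open O2 & [set x | s x k = i] = O1 `\` O2]].
Proof.
have cR : metric_complete (R^o : metricType R).
  move=> F FF cF; exists (lim F : R).
  exact: (@cauchy_cvg R F FF cF).
have dq : dense (range (qseq R)).
  move=> O [x Ox] oO.
  have : nbhs x O by exact: open_nbhs_nbhs.
  move=> /nbhs_ballP[e /= e0 eO].
  have [n /andP[xn nx]] := @qseq_itv R x (x + e) ltac:(by rewrite ltrDl).
  exists (qseq R n); split; last by exists n.
  by apply: eO; rewrite /ball /= ltr_distlC; lra.
exact: (@polish_param R R^o (qseq R) cR dq).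
Qed.

(** The first two clauses say that the topology of [X] is induced by [e], in the quantitative form
    used by the estimates below. *)
Definition dense_embedding (R : realType) (M : metricType R)
    (X : topologicalType) (e : X -> M) (d : nat -> X) : Prop :=
  [/\ continuous e,
      forall x U, nbhs x U ->
        exists r, forall y, mdist (e y) (e x) < (2 ^+ r)^-1 -> U y &
      dense (range d)].

Lemma dense_seq_near (X : topologicalType) (d : nat -> X) (x : X) (U : set X) :
  dense (range d) -> nbhs x U -> exists k, U (d k).
Proof.
move=> dd; rewrite nbhsE => -[V [oV Vx] VU].
have [|y [Oy [k _ yE]]] := dd V _ oV; first by exists x.
by exists k; rewrite yE; exact: VU.
Qed.

Lemma near_embed (R : realType) (M : metricType R) (X : topologicalType)
    (e : X -> M) (x : X) (y : M) (r : R) :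
  continuous e -> mdist (e x) y < r -> \forall z \near x, mdist (e z) y < r.
Proof. by move=> ce xr; exact: (ce x [set z | mdist z y < r] (near_mdist_lt xr)). Qed.

Definition extendable (R : realType) (X : topologicalType) (d : nat -> X)
    (g : nat -> R) : Prop :=
  exists f : X -> R,
    [/\ continuous f, exists B, forall x, `|f x| <= B & forall k, f (d k) = g k].

Definition oscillates (R : realType) (M : metricType R) (X : topologicalType)
    (e : X -> M) (d : nat -> X) (g : nat -> R) (y : M) (a b : nat) : Prop :=
  forall r, (exists k, mdist (e (d k)) y < (2 ^+ r)^-1 /\ g k < qseq R a) /\
            (exists k, mdist (e (d k)) y < (2 ^+ r)^-1 /\ qseq R b < g k).

(** For the converse, the extension at [x] is the upper limit of [g] along the points [d k] near
    [x]; without oscillation it is a limit. Continuity follows by comparing the values at two close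
    points with [g] at some [d k] near both. *)
Lemma extendable_osc (R : realType) (M : metricType R) (X : topologicalType)
    (e : X -> M) (d : nat -> X) (g : nat -> R) : dense_embedding e d ->
  extendable d g <->
  (exists N : nat, forall k, `|g k| <= N%:R) /\
  ~ (exists a b x, qseq R a < qseq R b /\ oscillates e d g (e x) a b).
Proof.
move=> [ce he dd]; split.
  move=> [f [cf [B fB] fg]]; split.
    exists (Num.truncn B).+1 => k; rewrite -fg; apply: le_trans (fB _) _.
    by apply: ltW; exact: truncnS_gt.
  move=> [a [b [x [ab osc]]]].
  have [xa|xa] := ltP (qseq R a) (f x).
    have [r hr] := he _ _ (cf x _ (lt_nbhsr xa)).
    have [[k [kx gk]] _] := osc r.
    by have := hr _ kx; rewrite /= fg ltNge ltW.
  have xb : f x < qseq R b by exact: le_lt_trans ab.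
  have [r hr] := he _ _ (cf x _ (lt_nbhsl xb)).
  have [_ [k [kx gk]]] := osc r.
  by have := hr _ kx; rewrite /= fg ltNge ltW.
move=> [[N gN] nosc].
have near_d x r : exists k, mdist (e (d k)) (e x) < (2 ^+ r)^-1.
  have : \forall y \near x, mdist (e y) (e x) < (2 ^+ r)^-1.
    by apply: near_embed => //; rewrite mdistxx invX2_gt0.
  by move=> /(dense_seq_near dd).
have /choice[f hf] : forall x, exists y : R, forall ep, 0 < ep ->
    exists r, forall k, mdist (e (d k)) (e x) < (2 ^+ r)^-1 -> `|g k - y| <= ep.
  (* [sup S] is the upper limit of [g] at [x]. *)
  move=> x; pose S := [set b : R | forall r,
    exists k, mdist (e (d k)) (e x) < (2 ^+ r)^-1 /\ b < g k].
  have S0 : S (- N%:R - 1).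
    move=> r; have [k kx] := near_d x r; exists k; split=> //.
    by have := gN k; rewrite ler_norml => /andP[]; lra.
  have SN : ubound S N%:R.
    move=> b /(_ 0%N)[k [_ bk]]; apply: ltW; apply: lt_le_trans bk _.
    by have := gN k; rewrite ler_norml => /andP[].
  have hS : has_sup S by split; [exists (- N%:R - 1)|exists N%:R].
  exists (sup S) => ep ep0.
  have [r1 h1] : exists r, forall k, mdist (e (d k)) (e x) < (2 ^+ r)^-1 ->
      g k <= sup S + ep.
    apply: contrapT => /forallNP h.
    have : S (sup S + ep).
      move=> r; have /existsNP[k /not_implyP[kx /negP]] := h r.
      by rewrite -ltNge => gk; exists k.
    move=> /(sup_upper_bound hS); apply/negP; rewrite -ltNge; lra.
  have [r2 h2] : exists r, forall k, mdist (e (d k)) (e x) < (2 ^+ r)^-1 ->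
      sup S - ep <= g k.
    apply: contrapT => /forallNP h.
    (* If [g] fell below [sup S - ep] arbitrarily near [x], it would oscillate between two rationals
       chosen in the gap from [sup S - ep] to [sup S - ep / 2], as it also exceeds the latter
       arbitrarily near [x]. *)
    have [a /andP[a1 a2]] := @qseq_itv R (sup S - ep) (sup S - ep / 2) ltac:(lra).
    have [b /andP[b1 b2]] := qseq_itv a2.
    apply: nosc; exists a, b, x; split=> // r; split.
      have /existsNP[k /not_implyP[kx /negP]] := h r.
      by rewrite -ltNge => gk; exists k; split=> //; exact: lt_trans a1.
    have [c Sc bc] := @sup_adherent R S (ep / 2) ltac:(lra) hS.
    by have [k [kx ck]] := Sc r; exists k; split=> //; lra.
  exists (maxn r1 r2) => k kx; rewrite ler_distl; apply/andP; split.
    by apply: h2; apply: lt_le_trans kx _; apply: invX2_le; exact: leq_maxr.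
  by apply: h1; apply: lt_le_trans kx _; apply: invX2_le; exact: leq_maxl.
exists f; split.
- move=> x; apply/cvgrPdist_le => ep ep0.
  have [r hr] := hf x (ep / 2) ltac:(lra).
  have : \forall y \near x, mdist (e y) (e x) < (2 ^+ r.+1)^-1.
    by apply: near_embed => //; rewrite mdistxx invX2_gt0.
  apply: filterS => y yx.
  have [r' hr'] := hf y (ep / 2) ltac:(lra).
  have [k ky] := near_d y (maxn r.+1 r').
  have ky1 : mdist (e (d k)) (e y) < (2 ^+ r.+1)^-1.
    by apply: lt_le_trans ky _; apply: invX2_le; exact: leq_maxl.
  have ky2 : mdist (e (d k)) (e y) < (2 ^+ r')^-1.
    by apply: lt_le_trans ky _; apply: invX2_le; exact: leq_maxr.
  have kx : mdist (e (d k)) (e x) < (2 ^+ r)^-1.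
    apply: le_lt_trans (metric_triangle _ (e y) _) _.
    by move: yx ky1; rewrite invX2S; lra.
  have := hr k kx; have := hr' k ky2; rewrite !ler_norml; lra.
- exists (N%:R + 1) => x; have [r hr] := hf x 1 ltac:(lra).
  have [k kx] := near_d x r; have := hr k kx; have := gN k.
  by rewrite !ler_norml; lra.
(* The point [d k] is itself among the points near [d k], so the limit there can only be [g k]. *)
- move=> k; apply/eqP; rewrite -subr_eq0 -normr_le0.
  apply/ler_addgt0Pl => ep ep0; rewrite addr0 distrC.
  by have [r hr] := hf (d k) _ ep0; apply: hr; rewrite mdistxx invX2_gt0.
Qed.

(** * The coding of bounded continuous functions *)

Definition borel_section (T : topologicalType) (p : baire -> T) (s : T -> baire)
    : Prop :=
  [/\ continuous p, forall x, p (s x) = x &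
    forall k i, exists O1 O2 : set T,
      [/\ open O1, open O2 & [set x | s x k = i] = O1 `\` O2]].

Definition bcode (T : Type) (s : T -> baire) (g : nat -> T) : baire :=
  fun n => s (g (nleft n)) (nright n).

Definition bdecode (T : Type) (p : baire -> T) (w : baire) (k : nat) : T :=
  p (brow w k).

Lemma bcodeK (T : topologicalType) (p : baire -> T) (s : T -> baire) g :
  borel_section p s -> bdecode p (bcode s g) = g.
Proof.
move=> [_ ps _]; apply/funext => k.
by rewrite /bdecode /bcode (brow_npair (fun k => s (g k))).
Qed.

Lemma bdecode_continuous (T : topologicalType) (p : baire -> T) k :
  continuous p -> continuous (bdecode p ^~ k).
Proof. by move=> cp; exact: (continuous_compose cp (@brow_continuous k)). Qed.

Lemma Sigma1_cst (P : topologicalType) m (Q : Prop) : open_fsigma P ->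
  Sigma1 m.+1 [set x : P | Q].
Proof.
move=> hP; have [_ op] := Sigma1_closed_open m hP.
apply: op; have [q|q] := pselect Q.
  by rewrite (_ : [set x | _] = setT); [exact: openT|apply/seteqP; split].
by rewrite (_ : [set x | _] = set0); [exact: open0|apply/seteqP; split].
Qed.

(** This is the range of the embedding [Cp_code], the set whose completeness is to be shown. *)
Definition code_range (R : realType) (X : topologicalType) (s : R -> baire)
    (d : nat -> X) : set baire :=
  [set w | exists g, extendable d g /\ w = bcode s g].

(** A sequence has many codes under [bdecode], but only the one chosen by [s] lies in the range.
    Being another one is witnessed at a single coordinate, where the value of the canonical code is
    given by a difference of open sets. *)
Lemma invalid_code_Sigma1 (R : realType) m (p : baire -> R) (s : R -> baire) :
  borel_section p s -> Sigma1 m.+1 [set w | bcode s (bdecode p w) <> w].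
Proof.
move=> [cp ps lev]; have bf := baire_open_fsigma R.
have [cl op] := Sigma1_closed_open m bf.
rewrite (_ : [set w | _] = \bigcup_n \bigcup_i
   ([set w | bcode s (bdecode p w) n = i] `&` [set w | w n <> i])).
  apply: Sigma1_bigcup => n; apply: Sigma1_bigcup => i; apply: Sigma1_setI.
    have [V1 [V2 [vop1 vop2 E]]] := lev (nright n) i.
    have cd := bdecode_continuous (k := nleft n) cp.
    rewrite (_ : [set w | _] = bdecode p ^~ (nleft n) @^-1` V1 `&`
      bdecode p ^~ (nleft n) @^-1` (~` V2)).
      apply: Sigma1_setI; first by apply: op; exact: open_preimage.
      by apply: cl; apply: closed_preimage => //; exact: open_closedC.
    by rewrite -preimage_setI -setDE -E.
  apply: op; rewrite openE => w /= wi; rewrite /interior.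
  by apply: filterS (near_baire w n) => w' /= ->.
apply/seteqP; split=> [w wn|w [n _ [i _ [<- h]]] /esym wE]; last first.
  by apply: h; rewrite {1}wE.
have [n hn] : exists n, bcode s (bdecode p w) n <> w n.
  by apply: contrapT => /forallNP h; apply: wn; apply/funext => n;
    apply: contrapT => hn; exact: (h n).
by exists n => //; exists (bcode s (bdecode p w) n) => //; split=> //= /esym.
Qed.

(** A point [w] is outside the range for one of three reasons: it is not a canonical code, its
    sequence is unbounded, or its sequence oscillates at a point of [range e]. Only the third
    involves [X]; there the point is quantified through a code [z], with [range e] pulled back along
    [pM]. *)
Lemma code_range_Pi1 (R : realType) (M : metricType R) (X : topologicalType)
    (e : X -> M) (d : nat -> X) (pR : baire -> R) (sR : R -> baire)
    (pM : baire -> M) (sM : M -> baire) m :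
  dense_embedding e d -> borel_section pR sR -> borel_section pM sM ->
  Sigma1 m.+1 (range e) -> Pi1 m.+1 (code_range sR d).
Proof.
move=> de bsR bsM sX; have bf := baire_open_fsigma R.
have bf2 := open_fsigma_prod bf.
have [cR psR levR] := bsR; have [cM psM levM] := bsM.
have [cl op] := Sigma1_closed_open m bf.
have [cl2 op2] := Sigma1_closed_open m bf2.
pose g (w : baire) := bdecode pR w.
rewrite /Pi1 (_ : ~` _ = [set w | bcode sR (g w) <> w] `|`
  (\bigcap_N \bigcup_k [set w | N%:R < `|g w k|]) `|`
  fst @` ([set u : baire * baire | range e (pM u.2)] `&`
    \bigcup_a \bigcup_b ([set u | qseq R a < qseq R b] `&`
      \bigcap_r ((\bigcup_k ([set u | mdist (e (d k)) (pM u.2) < (2 ^+ r)^-1] `&`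
                             [set u | g u.1 k < qseq R a])) `&`
                 (\bigcup_k ([set u | mdist (e (d k)) (pM u.2) < (2 ^+ r)^-1] `&`
                             [set u | qseq R b < g u.1 k])))))).
  have cg k : continuous (g ^~ k) by exact: bdecode_continuous.
  have cg1 k : continuous (fun u : baire * baire => g u.1 k).
    exact: (continuous_compose (@cg k) (@continuous_fst baire baire)).
  have cp2 : continuous (fun u : baire * baire => pM u.2).
    exact: (continuous_compose cM (@continuous_snd baire baire)).
  have oM k r : open [set u : baire * baire |
      mdist (e (d k)) (pM u.2) < (2 ^+ r)^-1].
    have := open_preimage cp2 (open_mdist_lt (e (d k)) (2 ^+ r)^-1).
    by under eq_set do rewrite metric_sym.
  apply: Sigma1_setU; first apply: Sigma1_setU.
  - exact: invalid_code_Sigma1.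
  - apply: Sigma1_bigcap => N; apply: Sigma1_bigcup => k; apply: op.
    have cn : continuous (fun w => `|g w k|).
      exact: (continuous_compose (@norm_continuous _ R) (@cg k)).
    exact: (open_preimage cn (@open_gt R N%:R)).
  - apply: Sigma1_proj; apply: Sigma1_setI.
      exact: (Sigma1_preimage cp2 sX).
    apply: Sigma1_bigcup => a; apply: Sigma1_bigcup => b; apply: Sigma1_setI.
      exact: Sigma1_cst.
    apply: Sigma1_bigcap => r; apply: Sigma1_setI; apply: Sigma1_bigcup => k;
      apply: Sigma1_setI; apply: op2 => //.
      exact: (open_preimage (@cg1 k) (@open_lt R (qseq R a))).
    exact: (open_preimage (@cg1 k) (@open_gt R (qseq R b))).
have extE w : extendable d (g w) <-> _ := extendable_osc (g w) de.
apply/seteqP; split=> w.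
  move=> nw; have [cw|cw] := pselect (bcode sR (g w) = w); last by left; left.
  have nex : ~ extendable d (g w).
    by move=> ex; apply: nw; exists (g w).
  have [bd|nb] := pselect (exists N : nat, forall k, `|g w k| <= N%:R); last first.
    left; right => N _; apply: contrapT => h; apply: nb; exists N => k.
    by rewrite leNgt; apply/negP => hk; apply: h; exists k.
  right; have [a [b [x [ab osc]]]] : exists a b x,
      qseq R a < qseq R b /\ oscillates e d (g w) (e x) a b.
    by apply: contrapT => h; apply: nex; apply/extE.
  exists (w, sM (e x)) => //; split; first by exists x; rewrite //= psM.
  exists a => //; exists b => //; split=> //= r _.
  have [[k hk] [l hl]] := osc r.
  by split; [exists k|exists l]; rewrite //= psM.
move=> h [g0 [ex wE]].
have gE : g w = g0 by rewrite /g wE; exact: bcodeK.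
rewrite -gE in ex; have [[N hN] nosc] := (extE w).1 ex.
case: h => [[h|h]|].
- by apply: h; rewrite gE -wE.
- by have [k _ /=] := h N I; rewrite ltNge hN.
- move=> [[w' z] /= [[x _ xz] [a _ [b _ [ab osc]]]] wE']; subst w'.
  apply: nosc; exists a, b, x; split=> // r; rewrite xz.
  by have [[k _ hk] [l _ hl]] := osc r I; split; [exists k|exists l].
Qed.

Lemma measurable_cyl d (T : measurableType d) (F : T -> baire) (s : seq nat) :
  (forall n i, measurable [set t | F t n = i]) ->
  measurable [set t | forall i, (i < size s)%N -> F t i = nth 0%N s i].
Proof.
move=> mF.
rewrite (_ : [set t | _] = \bigcap_i
    [set t | (i < size s)%N -> F t i = nth 0%N s i]).
  apply: bigcapT_measurable => i.
  have [is_|si] := ltnP i (size s); last first.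
    rewrite (_ : [set t | _] = setT); first exact: measurableT.
    by apply/seteqP; split.
  rewrite (_ : [set t | _] = [set t | F t i = nth 0%N s i]); first exact: mF.
  by apply/seteqP; split=> t /=; [apply|].
by apply/seteqP; split=> t h i; [move=> _; apply: h|exact: (h i I)].
Qed.

Lemma measurable_to_baire d (T : measurableType d) (F : T -> borel baire) :
  (forall n i, measurable [set t | F t n = i]) -> measurable_fun setT F.
Proof.
move=> mF; apply: (@measurability _ _ T (borel baire) setT F (@open baire)) => // _ [U oU <-].
rewrite setTI.
(* An open set is the union of the cylinders it contains, which are indexed by finite sequences and
   hence countable in number. *)
pose C (n : nat) : set T := if @unpickle (seq nat) n is Some s then
  if `[< forall y : baire, (forall i, (i < size s)%N -> y i = nth 0%N s i) -> U y >]
  then [set t | forall i, (i < size s)%N -> F t i = nth 0%N s i] else set0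
  else set0.
rewrite (_ : _ @^-1` _ = \bigcup_n C n).
  apply: bigcupT_measurable => n; rewrite /C.
  case: unpickle => [s|]; last exact: measurable0.
  case: asboolP => _; last exact: measurable0.
  exact: (@measurable_cyl _ _ F).
apply/seteqP; split=> [t Ut|t [n _]]; last first.
  rewrite /C; case: unpickle => [s|//].
  by case: asboolP => // h; exact: h.
have /nbhs_baireP[n nU] : nbhs (F t : baire) U by exact: open_nbhs_nbhs.
exists (pickle (mkseq (F t : baire) n)) => //; rewrite /C pickleK.
case: asboolP => [_ i|h].
  by rewrite size_mkseq => ni; rewrite nth_mkseq.
exfalso; apply: h => y yF; apply: nU => i ni.
by rewrite yF ?size_mkseq// nth_mkseq.
Qed.

(** * The Borel embedding of the function space into the Baire space *)

Definition bc_val (R : realType) (X : topologicalType) (f : bc_fun R X) : X -> R :=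
  set_val (f : bounded_continuous R X).

Lemma bc_valP (R : realType) (X : topologicalType) (f : bc_fun R X) :
  continuous (bc_val f) /\ exists B, forall x, `|bc_val f x| <= B.
Proof. by have := set_valP (f : bounded_continuous R X). Qed.

Lemma bc_val_inj (R : realType) (X : topologicalType) (f f' : bc_fun R X) :
  bc_val f = bc_val f' -> f = f'.
Proof. by move=> h; apply: val_inj. Qed.

Lemma bc_evalP (R : realType) (X : topologicalType) (F : set_system (bc_fun R X))
    (f : bc_fun R X) : Filter F ->
  (forall x (A : set R), nbhs (bc_val f x) A -> F [set g | A (bc_val g x)]) ->
  F --> f.
Proof.
move=> FF hF A /=.
rewrite nbhsE => -[_ [[B Bop <-] Bf] BA].
pose G : set_system {ptws X -> R} := [set C | F [set g | C (bc_val g)]].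
have GF : Filter G.
  split=> /=.
  - exact: filterT.
  - by move=> P Q FP FQ; exact: filterI.
  - by move=> P Q PQ; apply: filterS => g; exact: PQ.
have Gf : G --> (bc_val f : {ptws X -> R}).
  apply/cvg_sup => x C; rewrite nbhsE => -[_ [[D Dop <-] Dx] DC].
  have FD : F [set g | D (bc_val g x)] by apply: hF; exact: open_nbhs_nbhs.
  suff : F [set g | C (bc_val g)] by [].
  by apply: filterS FD => g Dg; exact: (DC (bc_val g)).
have GB : F [set g | B (bc_val g)].
  by apply: (Gf B); exact: open_nbhs_nbhs.
suff : F A by [].
by apply: filterS GB => g; exact: BA.
Qed.

Lemma bc_eval_continuous (R : realType) (X : topologicalType) x :
  continuous (fun f : bc_fun R X => bc_val f x).
Proof.
move=> f A nA.
have := @initial_continuous (bounded_continuous R X) {ptws X -> R} set_val f.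
have := @proj_continuous X (fun=> R) x (bc_val f) A nA.
move=> h1 h2; exact: (h2 _ h1).
Qed.

Definition Cp_code (R : realType) (X : topologicalType) (s : R -> baire)
    (d : nat -> X) (f : Cp_star R X) : borel baire :=
  bcode s (fun k => bc_val f (d k)).

Lemma range_Cp_code (R : realType) (X : topologicalType) (s : R -> baire)
  (d : nat -> X) : range (Cp_code s d) = code_range s d.
Proof.
apply/seteqP; split=> w.
  move=> [f _ <-]; exists (fun k => bc_val f (d k)); split=> //.
  by have [cf bf] := bc_valP f; exists (bc_val f).
move=> [g [[f [cf bf fg]] ->]].
have fP : bounded_continuous R X (f : {ptws X -> R}) by [].
exists (SigSub (mem_set fP) : bounded_continuous R X) => //.
by congr bcode; apply/funext => k; exact: fg.
Qed.

Lemma dense_seq_eq (R : realType) (X : topologicalType) (d : nat -> X)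
    (f g : X -> R) : dense (range d) -> continuous f -> continuous g ->
  (forall k, f (d k) = g (d k)) -> f = g.
Proof.
move=> dd cf cg fg; apply/funext => x; apply/eqP; rewrite -subr_eq0.
apply/negPn/negP => fgx.
have cfg : continuous (fun x => f x - g x).
  by move=> y; apply: cvgB; [exact: cf|exact: cg].
have := cfg x _ (open_nbhs_nbhs (conj (@open_neq R 0) fgx)).
move=> /(dense_seq_near dd)[k] /=.
by rewrite fg subrr eqxx.
Qed.

Lemma Cp_code_inj (R : realType) (X : topologicalType) (p : baire -> R)
    (s : R -> baire) (d : nat -> X) :
  borel_section p s -> dense (range d) -> injective (@Cp_code R X s d).
Proof.
move=> bs dd f g fg; apply: bc_val_inj.
have [cf _] := bc_valP f; have [cg _] := bc_valP g.
apply: (dense_seq_eq dd cf cg) => k.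
have := congr1 (fun w => bdecode p w k) fg.
by rewrite /Cp_code !(bcodeK _ bs).
Qed.

Lemma Cp_code_measurable (R : realType) (X : topologicalType) (p : baire -> R)
    (s : R -> baire) (d : nat -> X) :
  borel_section p s -> measurable_fun setT (@Cp_code R X s d).
Proof.
move=> [_ _ lev]; apply: measurable_to_baire => n i.
have [V1 [V2 [op1 op2 E]]] := lev (nright n) i.
have ce := @bc_eval_continuous R X (d (nleft n)).
rewrite (_ : [set f | _] = (fun f : bc_fun R X => bc_val f (d (nleft n))) @^-1` V1 `\`
   (fun f : bc_fun R X => bc_val f (d (nleft n))) @^-1` V2).
  apply: measurableD; apply: sub_sigma_algebra; exact: open_preimage.
by rewrite setDE preimage_setC -preimage_setI -setDE -E.
Qed.

(* Indices of the countable network of the space of continuous functions: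
   (i, r, a, b) stands for the functions mapping the points near [d i]
   into [qseq a, qseq b]. *)
Definition net_index : Type := (nat * nat * nat * nat)%type.

Definition in_net (R : realType) (M : metricType R) (X : topologicalType)
    (e : X -> M) (d : nat -> X) (l : seq net_index) (g : nat -> R) : Prop :=
  forall c, c \in l -> forall k,
    mdist (e (d k)) (e (d c.1.1.1)) < (2 ^+ c.1.1.2)^-1 ->
    qseq R c.1.2 <= g k <= qseq R c.2.

(** The topology of pointwise convergence need not have a countable base, but it has a countable
    network of sets depending only on the values along [d]; this is why evaluations at [d] generate
    all Borel sets. For one evaluation at [x], a ball around some [d i] contains [x] and is mapped
    by [f] into a small rational interval; for any continuous [g], bounds at the points of [d] in
    that ball pass to [x] by density. *)
Lemma net_nbhs (R : realType) (M : metricType R) (X : topologicalType)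
    (e : X -> M) (d : nat -> X) (f : bc_fun R X) (A : set (bc_fun R X)) :
  dense_embedding e d -> nbhs f A ->
  exists l, in_net e d l (fun k => bc_val f (d k)) /\
    forall g : bc_fun R X, in_net e d l (fun k => bc_val g (d k)) -> A g.
Proof.
move=> [ce he dd].
pose G : set_system (bc_fun R X) := [set B | exists l,
  in_net e d l (fun k => bc_val f (d k)) /\
  forall g : bc_fun R X, in_net e d l (fun k => bc_val g (d k)) -> B g].
have GF : Filter G.
  split=> /=.
  - by exists [::].
  - move=> P Q [l1 [fl1 lP]] [l2 [fl2 lQ]]; exists (l1 ++ l2); split.
      by move=> c; rewrite mem_cat => /orP[/fl1|/fl2].
    by move=> g gl; split; [apply: lP|apply: lQ] => c cl; apply: gl;
      rewrite mem_cat cl ?orbT.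
  - by move=> P Q PQ [l [fl lP]]; exists l; split=> // g /lP /PQ.
suff Gf : G --> f by move=> /Gf.
apply: bc_evalP => x B /nbhs_ballP[ep /= ep0 epB].
have [a /andP[a1 a2]] :=
  @qseq_itv R (bc_val f x - ep) (bc_val f x - ep / 2) ltac:(lra).
have [b /andP[b1 b2]] :=
  @qseq_itv R (bc_val f x + ep / 2) (bc_val f x + ep) ltac:(lra).
have [cf _] := bc_valP f.
have [r hr] : exists r, forall y, mdist (e y) (e x) < (2 ^+ r)^-1 ->
    `|bc_val f x - bc_val f y| < ep / 2.
  apply: he; apply: (cf x (fun z => `|bc_val f x - z| < ep / 2)).
  by apply/nbhs_ballP; exists (ep / 2) => //=; lra.
have [i ix] : exists i, mdist (e (d i)) (e x) < (2 ^+ r.+1)^-1.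
  apply: (dense_seq_near (x := x) dd (U := fun y => mdist (e y) (e x) < (2 ^+ r.+1)^-1)).
  by apply: near_embed => //; rewrite mdistxx invX2_gt0.
exists [:: (i, r.+1, a, b)]; split.
  move=> c; rewrite inE => /eqP -> k /= ki.
  have /hr : mdist (e (d k)) (e x) < (2 ^+ r)^-1.
    apply: le_lt_trans (metric_triangle _ (e (d i)) _) _.
    by move: ix ki; rewrite invX2S; lra.
  by rewrite ltr_distlC => /andP[h1 h2]; apply/andP; split; lra.
move=> g gl; apply: epB; rewrite /ball /= ltr_distlC.
have [cg _] := bc_valP g.
have nx : \forall y \near x, mdist (e y) (e (d i)) < (2 ^+ r.+1)^-1.
  by apply: near_embed => //; rewrite metric_sym.
suff /andP[h1 h2] : qseq R a <= bc_val g x <= qseq R b by apply/andP; split; lra.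
apply/andP; split; rewrite leNgt; apply/negP => h.
  have ny : \forall y \near x, bc_val g y < qseq R a.
    exact: (cg x _ (lt_nbhsl h)).
  have [k [k1 k2]] := dense_seq_near dd (filterI nx ny).
  by have := gl (i, r.+1, a, b) (mem_head _ _) k k1; rewrite /= leNgt k2.
have ny : \forall y \near x, qseq R b < bc_val g y.
  exact: (cg x _ (lt_nbhsr h)).
have [k [k1 k2]] := dense_seq_near dd (filterI nx ny).
by have := gl (i, r.+1, a, b) (mem_head _ _) k k1; rewrite /= andbC leNgt k2.
Qed.

Lemma in_net_measurable (R : realType) (M : metricType R) (X : topologicalType)
    (e : X -> M) (d : nat -> X) (p : baire -> R) (l : seq net_index) :
  continuous p ->
  measurable [set w : borel baire | in_net e d l (bdecode p w)].
Proof.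
move=> cp; rewrite (_ : [set w | _] = \bigcap_n \bigcap_k
  [set w : borel baire | if @unpickle net_index n is Some c then
    c \in l -> mdist (e (d k)) (e (d c.1.1.1)) < (2 ^+ c.1.1.2)^-1 ->
    qseq R c.1.2 <= bdecode p w k <= qseq R c.2 else True]).
  apply: bigcapT_measurable => n; apply: bigcapT_measurable => k.
  case: unpickle => [c|]; last exact: measurableT.
  have [cl|cl] := pselect (c \in l /\
      mdist (e (d k)) (e (d c.1.1.1)) < (2 ^+ c.1.1.2)^-1); last first.
    rewrite (_ : [set w | _] = setT); first exact: measurableT.
    by apply/seteqP; split=> // w _ /= h1 h2; exfalso; apply: cl.
  have cd := bdecode_continuous (k := k) cp.
  rewrite (_ : [set w | _] = ~` ((bdecode p ^~ k @^-1` [set x | x < qseq R c.1.2]) `|`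
      (bdecode p ^~ k @^-1` [set x | qseq R c.2 < x]))).
    apply: measurableC; apply: measurableU; apply: sub_sigma_algebra.
      exact: (open_preimage cd (@open_lt R _)).
    exact: (open_preimage cd (@open_gt R _)).
  rewrite setCU; apply/seteqP; split=> w /=.
    by move=> /(_ cl.1 cl.2)/andP[h1 h2]; split; apply/negP; rewrite -leNgt.
  by move=> [/negP + /negP]; rewrite -!leNgt => -> ->.
apply/seteqP; split=> w h.
  by move=> n _ k _ /=; case: unpickle => // c cl; exact: h.
move=> c cl k ki; have := h (pickle c) I k I; rewrite /= pickleK; exact.
Qed.

(** The sets whose image is the trace of a Borel set on the range form a sigma-algebra, complements
    being handled by injectivity, so open sets suffice. By [net_nbhs], an open set is a countable
    union of network sets, each given by a Borel condition on the code. *)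
Lemma Cp_code_embedding (R : realType) (M : metricType R) (X : topologicalType)
    (e : X -> M) (d : nat -> X) (p : baire -> R) (s : R -> baire) :
  dense_embedding e d -> borel_section p s ->
  measurable_embedding (@Cp_code R X s d).
Proof.
move=> de bs; have [ce he dd] := de; have [cp _ _] := bs.
have inj := Cp_code_inj bs dd.
split=> //; first exact: (Cp_code_measurable d bs).
pose F := @Cp_code R X s d.
have dF (f : Cp_star R X) : bdecode p (F f) = fun k => bc_val f (d k).
  exact: bcodeK.
apply: smallest_sub.
  split.
  - by exists set0; [exact: measurable0|rewrite image_set0 set0I].
  - move=> A [B mB AB]; exists (~` B); first exact: measurableC.
    apply/seteqP; split=> w.
      move=> [f [_ nA] <-]; split; last by exists f.
      move=> Bf; apply: nA.
      have : (B `&` range F) (F f) by split=> //; exists f.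
      by rewrite -AB => -[f' Af' /inj <-].
    move=> [nB [f _ fw]]; exists f => //; split=> // Af; apply: nB.
    have : (F @` A) w by exists f.
    by rewrite AB => -[].
  - move=> A hA.
    have /choice[B hB] : forall n, exists B : set (borel baire),
        measurable B /\ F @` (A n) = B `&` range F.
      by move=> n; have [B h1 h2] := hA n; exists B.
    exists (\bigcup_n B n); first by apply: bigcupT_measurable => n; have [] := hB n.
    rewrite image_bigcup setI_bigcupl; apply: eq_bigcupr => n _.
    by have [] := hB n.
move=> A oA.
pose B (n : nat) : set (borel baire) := if @unpickle (seq net_index) n is Some l then
  if `[< forall g : bc_fun R X, in_net e d l (fun k => bc_val g (d k)) -> A g >]
  then [set w | in_net e d l (bdecode p w)] else set0 else set0.
exists (\bigcup_n B n).
  apply: bigcupT_measurable => n; rewrite /B; case: unpickle => [l|//].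
  by case: asboolP => // _; exact: in_net_measurable.
apply/seteqP; split=> w.
  move=> [f Af <-]; split; last by exists f.
  have /(net_nbhs de)[l [fl lA]] : nbhs (f : bc_fun R X) A by exact: open_nbhs_nbhs.
  exists (pickle l) => //; rewrite /B pickleK; case: asboolP => // _.
  by rewrite /= dF.
move=> [[n _]]; rewrite /B; case: unpickle => [l|//]; case: asboolP => // lA wl.
by move=> [f _ fw]; exists f => //; apply: lA; rewrite -dF /F fw.
Qed.

(** * An oscillating function *)

Definition sdist (R : realType) (M : metricType R) (K : set M) (x : M) : R :=
  inf [set mdist x y | y in K].

Lemma sdist_lb (R : realType) (M : metricType R) (K : set M) (x : M) :
  has_lbound [set mdist x y | y in K].
Proof. by exists 0 => _ [y _ <-]; exact: mdist_ge0. Qed.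

Lemma sdist_le (R : realType) (M : metricType R) (K : set M) (x y : M) :
  K y -> sdist K x <= mdist x y.
Proof. by move=> Ky; apply: (ge_inf (sdist_lb K x)); exists y. Qed.

Lemma sdist_ge (R : realType) (M : metricType R) (K : set M) (x : M) (r : R) :
  K !=set0 -> (forall y, K y -> r <= mdist x y) -> r <= sdist K x.
Proof.
move=> [y Ky] h; apply: lb_le_inf; first by exists (mdist x y), y.
by move=> _ [z Kz <-]; exact: h.
Qed.

Lemma sdist_ltP (R : realType) (M : metricType R) (K : set M) (x : M) (r : R) :
  K !=set0 -> sdist K x < r <-> exists2 y, K y & mdist x y < r.
Proof.
move=> K0; split=> [h|[y Ky]]; last by apply: le_lt_trans; exact: sdist_le.
apply: contrapT => nh; move: h; apply/negP; rewrite -leNgt.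
apply: sdist_ge => // y Ky; rewrite leNgt; apply/negP => h; apply: nh.
by exists y.
Qed.

Lemma sdist_ge0 (R : realType) (M : metricType R) (K : set M) (x : M) :
  K !=set0 -> 0 <= sdist K x.
Proof. by move=> K0; apply: sdist_ge => // y _; exact: mdist_ge0. Qed.

Lemma sdist_lip (R : realType) (M : metricType R) (K : set M) (x y : M) :
  K !=set0 -> sdist K x <= mdist x y + sdist K y.
Proof.
move=> K0; rewrite -lerBlDl; apply: sdist_ge => // z Kz; rewrite lerBlDl.
by apply: le_trans (sdist_le x Kz) _; exact: metric_triangle.
Qed.

Lemma sdist_mem (R : realType) (M : metricType R) (K : set M) (x : M) :
  K x -> sdist K x = 0.
Proof.
move=> Kx; apply/eqP; rewrite eq_le sdist_ge0 ?andbT; last by exists x.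
by have := sdist_le x Kx; rewrite mdistxx.
Qed.

Lemma sdist_gt0 (R : realType) (M : metricType R) (K : set M) (x : M) :
  K !=set0 -> closed K -> ~ K x -> 0 < sdist K x.
Proof.
move=> K0 cK nK.
have : nbhs x (~` K) by apply: open_nbhs_nbhs; split=> //; exact: closed_openC.
move=> /nbhs_mdist_exP[e e0 eK]; apply: lt_le_trans e0 _.
apply: sdist_ge => // y Ky; rewrite leNgt; apply/negP => /eK; exact.
Qed.

Lemma sdist_continuous (R : realType) (M : metricType R) (K : set M) :
  K !=set0 -> continuous (sdist K).
Proof.
move=> K0 x; apply/cvgrPdist_le => ep ep0.
apply/nbhs_mdist_exP; exists ep => // y xy.
have h1 := sdist_lip x y K0; have h2 := sdist_lip y x K0.
rewrite [mdist y x]metric_sym in h2.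
by rewrite ler_distl; apply/andP; split; lra.
Qed.

(** Step [n] serves the ball coded by [n./2], with centre [D (nleft n./2)] and radius 2^-(nright
    n./2). Each ball is thus served at two consecutive steps, one even and one odd. In the
    application [rho] is the distance to [K], to be more than halved by the move. *)
Definition candidate (R : realType) (M : metricType R) (D : nat -> M)
    (rho : nat -> R) (n i k : nat) : Prop :=
  mdist (D k) (D (nleft n./2)) < (2 ^+ nright n./2)^-1 /\ rho k < rho i / 2.

(** The least candidate is taken so that the choice is Borel in [rho]. Without a candidate the
    sequence stays where it is, and [moved] tells the two cases apart. *)
Definition next (R : realType) (M : metricType R) (D : nat -> M)
    (rho : nat -> R) (n i : nat) : nat :=
  if pselect (exists k, `[< candidate D rho n i k >]) is left h
  then ex_minn h else i.

Fixpoint greedy (R : realType) (M : metricType R) (D : nat -> M)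
    (rho : nat -> R) (n : nat) : nat :=
  if n is m.+1 then next D rho m (greedy D rho m) else 0%N.

Definition moved (R : realType) (M : metricType R) (D : nat -> M)
    (rho : nat -> R) (n : nat) : Prop :=
  exists k, candidate D rho n (greedy D rho n) k.

Definition greedy_even (R : realType) (M : metricType R) (D : nat -> M)
    (rho : nat -> R) : set nat :=
  [set i | exists n, [/\ ~~ odd n, moved D rho n & i = greedy D rho n.+1]].

(** The graph of [next] in terms of countable quantifiers over [candidate], the form from which
    measurability is read off. *)
Lemma nextP (R : realType) (M : metricType R) (D : nat -> M) (rho : nat -> R) n i k :
  next D rho n i = k <->
  (candidate D rho n i k /\ forall j, (j < k)%N -> ~ candidate D rho n i j) \/
  ((forall j, ~ candidate D rho n i j) /\ k = i).
Proof.
rewrite /next; case: pselect => [h|h]; last first.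
  have nc j : ~ candidate D rho n i j.
    by move=> c; apply: h; exists j; apply/asboolP.
  split=> [<-|[[/nc]//|[_ ->]//]]; by right.
case: ex_minnP => m /asboolP cm mmin; split.
  move=> <-; left; split=> // j jm /asboolP /mmin; by rewrite leqNgt jm.
move=> [[/asboolP /mmin mk lt]|[/(_ m)//]].
apply/eqP; rewrite eqn_leq mk /= leqNgt; apply/negP => /lt; exact.
Qed.

Lemma greedy_moved (R : realType) (M : metricType R) (D : nat -> M)
    (rho : nat -> R) n :
  moved D rho n -> candidate D rho n (greedy D rho n) (greedy D rho n.+1).
Proof.
move=> [k ck]; have /nextP := erefl (greedy D rho n.+1).
by move=> [[]//|[/(_ k)]].
Qed.

Lemma rho_greedyS (R : realType) (M : metricType R) (D : nat -> M)
    (rho : nat -> R) n : (forall k, 0 < rho k) ->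
  rho (greedy D rho n.+1) <= rho (greedy D rho n).
Proof.
move=> r0; have /nextP := erefl (greedy D rho n.+1).
move=> [[[_ h] _]|[_ ->//]]; have := r0 (greedy D rho n).
rewrite -/(greedy D rho n.+1) in h; lra.
Qed.

Lemma rho_greedy_le (R : realType) (M : metricType R) (D : nat -> M)
    (rho : nat -> R) m n : (forall k, 0 < rho k) -> (m <= n)%N ->
  rho (greedy D rho n) <= rho (greedy D rho m).
Proof.
move=> r0 /subnKC <-; elim: (n - m)%N => [|k ih]; first by rewrite addn0.
by rewrite addnS; apply: le_trans ih; exact: rho_greedyS.
Qed.

(* The points of the greedy sequence are separated on the scale of their
   distance to [K], so those of even index are far from those of odd index. *)
Lemma greedy_separated (R : realType) (M : metricType R) (D : nat -> M)
    (rho : nat -> R) m i : (forall k, 0 < rho k) ->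
  (forall k l, rho k <= mdist (D k) (D l) + rho l) ->
  odd m -> moved D rho m -> greedy_even D rho i ->
  rho (greedy D rho m.+1) / 2 <= mdist (D (greedy D rho m.+1)) (D i).
Proof.
move=> r0 lip om mm [n [en nm ->]].
set u := greedy D rho m.+1; set c := greedy D rho n.+1.
have h1 := lip u c; have h2 := lip c u; rewrite [mdist (D c) _]metric_sym in h2.
have ru := r0 u; have rc := r0 c.
(* The later of the two moves ends at a point with less than half the [rho] of the earlier one, and
   [lip] turns this gap into a distance. The moves differ, having opposite parities. *)
have [mn|nm'|mn] := ltngtP m n.
- have [_ h] := greedy_moved nm.
  have := rho_greedy_le D r0 mn; rewrite -/u -/c in h *; lra.
- have [_ h] := greedy_moved mm.
  have := rho_greedy_le D r0 nm'; rewrite -/u -/c in h *; lra.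
- by rewrite mn (negbTE en) in om.
Qed.

Definition osc_quotient (R : realType) (M : metricType R) (D : nat -> M)
    (K : set M) (x : M) : R :=
  sdist (K `|` D @` greedy_even D (fun k => sdist K (D k))) x / sdist K x.

Lemma osc_quotient_itv (R : realType) (M : metricType R) (D : nat -> M)
    (K : set M) (x : M) : K !=set0 -> 0 < sdist K x ->
  0 <= osc_quotient D K x <= 1.
Proof.
move=> K0 Kx; rewrite /osc_quotient.
have KF0 : (K `|` D @` greedy_even D (fun k => sdist K (D k))) !=set0.
  by have [y Ky] := K0; exists y; left.
apply/andP; split; first by rewrite divr_ge0 ?sdist_ge0.
rewrite ler_pdivrMr// mul1r; apply: sdist_ge => // y Ky.
by apply: sdist_le; left.
Qed.

Lemma osc_quotient_continuous (R : realType) (M : metricType R) (D : nat -> M)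
    (K : set M) (x : M) : K !=set0 -> 0 < sdist K x ->
  {for x, continuous (osc_quotient D K)}.
Proof.
move=> K0 Kx.
have KF0 : (K `|` D @` greedy_even D (fun k => sdist K (D k))) !=set0.
  by have [y Ky] := K0; exists y; left.
apply: cvgM; first exact: sdist_continuous.
by apply: cvgV; [rewrite gt_eqF|exact: sdist_continuous].
Qed.

Lemma osc_quotient_extendable (R : realType) (M : metricType R)
    (X : topologicalType) (e : X -> M) (d : nat -> X) (K : set M) :
  continuous e -> K !=set0 -> closed K -> (forall x, ~ K (e x)) ->
  extendable d (fun k => osc_quotient (e \o d) K (e (d k))).
Proof.
move=> ce K0 cK nK.
have pos x : 0 < sdist K (e x) by exact: sdist_gt0.
exists (fun x => osc_quotient (e \o d) K (e x)); split=> //.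
  move=> x; apply: (continuous_comp (ce x)).
  exact: osc_quotient_continuous.
exists 1 => x; have /andP[h1 h2] := osc_quotient_itv (e \o d) K0 (pos x).
by rewrite ger0_norm.
Qed.

(** Since [e x] belongs to [K] and is a limit of points of [d], every ball around it contains points
    with arbitrarily small [rho], so both steps serving a ball that contains [e x] are real moves.
    They give a value 0 and a value at least 1/2 near [x], whereas both should be within 1/8 of
    [f x]. *)
Lemma osc_quotient_not_extendable (R : realType) (M : metricType R)
    (X : topologicalType) (e : X -> M) (d : nat -> X) (K : set M) (x : X) :
  dense_embedding e d -> K (e x) -> (forall k, 0 < sdist K (e (d k))) ->
  ~ extendable d (fun k => osc_quotient (e \o d) K (e (d k))).
Proof.
move=> [ce he dd] Kx pos [f [cf _ fg]].
have K0 : K !=set0 by exists (e x).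
pose D := e \o d; pose rho k := sdist K (D k).
have [r hr] : exists r, forall y, mdist (e y) (e x) < (2 ^+ r)^-1 ->
    `|f x - f y| < 1 / 8.
  apply: he; apply: (cf x (fun z => `|f x - z| < 1 / 8)).
  by apply/nbhs_ballP; exists (1 / 8) => //=; lra.
have [i ix] : exists i, mdist (e (d i)) (e x) < (2 ^+ r.+1)^-1.
  apply: (dense_seq_near (x := x) dd (U := fun y => mdist (e y) (e x) < (2 ^+ r.+1)^-1)).
  by apply: near_embed => //; rewrite mdistxx invX2_gt0.
(* The ball of radius 2^-(r+1) around [D i] contains [e x] and stays within 2^-r of it; it is served
   at steps 2j and 2j+1, which lead to the terms of index 2j+1 and 2j+2. *)
pose j := npair i r.+1.
have mv n : n./2 = j -> moved D rho n.
  move=> nj.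
  have n1 : \forall y \near x, mdist (e y) (D i) < (2 ^+ r.+1)^-1.
    by apply: near_embed => //; rewrite metric_sym.
  have n2 : \forall y \near x, mdist (e y) (e x) < rho (greedy D rho n) / 2.
    by apply: near_embed => //; rewrite mdistxx divr_gt0//; exact: pos.
  have [k [k1 k2]] := dense_seq_near dd (filterI n1 n2).
  exists k; rewrite /candidate nj nleft_npair nright_npair; split=> //.
  by apply: le_lt_trans k2; exact: sdist_le.
have close n : n./2 = j ->
    `|f x - f (d (greedy D rho n.+1))| < 1 / 8.
  move=> nj; apply: hr.
  have [+ _] := greedy_moved (mv n nj).
  rewrite nj nleft_npair nright_npair => h.
  apply: le_lt_trans (metric_triangle _ (D i) _) _.
  by move: ix h; rewrite invX2S /D /=; lra.
have h1 := close j.*2 (doubleK j).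
have h2 := close j.*2.+1 (uphalf_double j).
have m1 := mv j.*2 (doubleK j); have m2 := mv j.*2.+1 (uphalf_double j).
have g1 : f (d (greedy D rho j.*2.+1)) = 0.
  rewrite fg /osc_quotient sdist_mem ?mul0r//; right.
  by exists (greedy D rho j.*2.+1) => //; exists j.*2; rewrite odd_double.
have g2 : 1 / 2 <= f (d (greedy D rho j.*2.+2)).
  rewrite fg /osc_quotient ler_pdivlMr; last exact: pos.
  apply: sdist_ge; first by exists (e x); left.
  move=> y [Ky|[c cF <-]].
    have := sdist_le (e (d (greedy D rho j.*2.+2))) Ky.
    by have := pos (greedy D rho j.*2.+2); lra.
  rewrite mul1r mulrC.
  apply: (@greedy_separated R M D rho j.*2.+1 c) => //.
  - by move=> k l; exact: sdist_lip.
  - by rewrite /= odd_double.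
by move: h1 h2; rewrite g1 subr0 !ltr_norml; lra.
Qed.

(** * Measurability of the construction *)

Lemma measurable_Prop d (T : measurableType d) (P : Prop) :
  measurable [set t : T | P].
Proof.
have [p|p] := pselect P.
  by rewrite (_ : [set t | _] = setT); [exact: measurableT|apply/seteqP; split].
by rewrite (_ : [set t | _] = set0); [exact: measurable0|apply/seteqP; split].
Qed.

Lemma measurable_forall d (T : measurableType d) (P : nat -> T -> Prop) :
  (forall n, measurable [set t | P n t]) -> measurable [set t | forall n, P n t].
Proof.
move=> mP; rewrite (_ : [set t | _] = \bigcap_n [set t | P n t]).
  exact: bigcapT_measurable.
by apply/seteqP; split=> t h n; [move=> _; exact: h|exact: (h n I)].
Qed.

Lemma measurable_exists d (T : measurableType d) (P : nat -> T -> Prop) :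
  (forall n, measurable [set t | P n t]) -> measurable [set t | exists n, P n t].
Proof.
move=> mP; rewrite (_ : [set t | _] = \bigcup_n [set t | P n t]).
  exact: bigcupT_measurable.
by apply/seteqP; split=> t [n]; [exists n|move=> _ h; exists n].
Qed.

Lemma measurable_and d (T : measurableType d) (P Q : T -> Prop) :
  measurable [set t | P t] -> measurable [set t | Q t] ->
  measurable [set t | P t /\ Q t].
Proof. exact: measurableI. Qed.

Lemma measurable_or d (T : measurableType d) (P Q : T -> Prop) :
  measurable [set t | P t] -> measurable [set t | Q t] ->
  measurable [set t | P t \/ Q t].
Proof. exact: measurableU. Qed.

Lemma measurable_not d (T : measurableType d) (P : T -> Prop) :
  measurable [set t | P t] -> measurable [set t | ~ P t].
Proof. exact: measurableC. Qed.

Lemma measurable_imply d (T : measurableType d) (P Q : T -> Prop) :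
  measurable [set t | P t] -> measurable [set t | Q t] ->
  measurable [set t | P t -> Q t].
Proof.
move=> mP mQ; rewrite (_ : [set t | _] = [set t | ~ P t \/ Q t]).
  by apply: measurable_or => //; exact: measurable_not.
apply/seteqP; split=> t /=; last by tauto.
by have := EM (P t); tauto.
Qed.

(** Measurability is phrased throughout with the rays below [q], the form in which it is known for
    distances to [K t]; here a rational is inserted between the two functions. *)
Lemma measurable_lt_ray d (T : measurableType d) (R : realType) (f g : T -> R) :
  (forall q, measurable [set t | f t < q]) ->
  (forall q, measurable [set t | g t < q]) ->
  measurable [set t | f t < g t].
Proof.
move=> mf mg.
rewrite (_ : [set t | _] =
  [set t | exists n, f t < qseq R n /\ ~ (g t < qseq R n)]).
  by apply: measurable_exists => n; apply: measurable_and;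
    [exact: mf|apply: measurable_not; exact: mg].
apply/seteqP; split=> t /=.
  by move=> /qseq_itv[n /andP[fn ng]]; exists n; split=> //; rewrite ltNge ltW.
move=> [n [fn /negP]]; rewrite -leNgt; exact: lt_le_trans.
Qed.

Lemma measurable_ray_scale d (T : measurableType d) (R : realType) (f : T -> R) c :
  0 < c -> (forall q, measurable [set t | f t < q]) ->
  forall q, measurable [set t | c * f t < q].
Proof.
move=> c0 mf q; rewrite (_ : [set t | _] = [set t | f t < q / c]).
  exact: mf.
by apply/seteqP; split=> t /=; rewrite ltr_pdivlMr// mulrC.
Qed.

Lemma measurable_ray_open d (T : measurableType d) (R : realType) (f : T -> R)
    (V : set R) : (forall q, measurable [set t | f t < q]) -> open V ->
  measurable [set t | V (f t)].
Proof.
move=> mf oV.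
rewrite (_ : [set t | _] = [set t | exists a b,
  (forall x, qseq R a <= x < qseq R b -> V x) /\
  (~ (f t < qseq R a) /\ f t < qseq R b)]).
  apply: measurable_exists => a; apply: measurable_exists => b.
  apply: measurable_and; first exact: measurable_Prop.
  by apply: measurable_and; [apply: measurable_not|]; exact: mf.
apply/seteqP; split=> t /=.
  move=> Vt; have : nbhs (f t) V by exact: open_nbhs_nbhs.
  move=> /nbhs_ballP[ep /= ep0 epV].
  have [a /andP[a1 a2]] := @qseq_itv R (f t - ep) (f t) ltac:(lra).
  have [b /andP[b1 b2]] := @qseq_itv R (f t) (f t + ep) ltac:(lra).
  exists a, b; split.
    move=> x /andP[ax xb]; apply: epV; rewrite /ball /= ltr_distlC.
    by apply/andP; split; lra.
  by split=> //; apply/negP; rewrite -leNgt ltW.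
by move=> [a [b [h [/negP + tb]]]]; rewrite -leNgt => ta; apply: h; rewrite ta.
Qed.

Lemma measurable_candidate d (T : measurableType d) (R : realType)
    (M : metricType R) (D : nat -> M) (rho : T -> nat -> R) n i k :
  (forall k q, measurable [set t | rho t k < q]) ->
  measurable [set t | candidate D (rho t) n i k].
Proof.
move=> mr; apply: measurable_and; first exact: measurable_Prop.
apply: measurable_lt_ray; first exact: mr.
move=> q; rewrite (_ : [set t | _] = [set t | 2^-1 * rho t i < q]).
  by apply: measurable_ray_scale; [rewrite invr_gt0|exact: mr].
by apply/seteqP; split=> t /=; rewrite mulrC.
Qed.

Lemma measurable_greedy d (T : measurableType d) (R : realType)
    (M : metricType R) (D : nat -> M) (rho : T -> nat -> R) n i :
  (forall k q, measurable [set t | rho t k < q]) ->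
  measurable [set t | greedy D (rho t) n = i].
Proof.
move=> mr; elim: n i => [|n ih] i; first exact: (@measurable_Prop _ T (0%N = i)).
have mc n' i' k := measurable_candidate D n' i' k mr.
rewrite (_ : [set t | _] = [set t | exists j, greedy D (rho t) n = j /\
  ((candidate D (rho t) n j i /\
    forall k, (k < i)%N -> ~ candidate D (rho t) n j k) \/
   ((forall k, ~ candidate D (rho t) n j k) /\ i = j))]).
  apply: measurable_exists => j; apply: measurable_and; first exact: ih.
  apply: measurable_or.
    apply: measurable_and => //; apply: measurable_forall => k.
    by apply: measurable_imply; [exact: measurable_Prop|exact: measurable_not].
  apply: measurable_and; last exact: measurable_Prop.
  by apply: measurable_forall => k; exact: measurable_not.
apply/seteqP; split=> t /=.
  by move=> /nextP h; exists (greedy D (rho t) n).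
by move=> [j [<- h]]; apply/nextP.
Qed.

Lemma measurable_greedy_even d (T : measurableType d) (R : realType)
    (M : metricType R) (D : nat -> M) (rho : T -> nat -> R) i :
  (forall k q, measurable [set t | rho t k < q]) ->
  measurable [set t | greedy_even D (rho t) i].
Proof.
move=> mr.
have mc n' i' k := measurable_candidate D n' i' k mr.
rewrite (_ : [set t | _] = [set t | exists n, (~~ odd n /\
    exists j, greedy D (rho t) n = j /\ exists k, candidate D (rho t) n j k) /\
   greedy D (rho t) n.+1 = i]).
  apply: measurable_exists => n; apply: measurable_and; last exact: measurable_greedy.
  apply: measurable_and; first exact: measurable_Prop.
  apply: measurable_exists => j; apply: measurable_and; first exact: measurable_greedy.
  by apply: measurable_exists.
apply/seteqP; split=> t /=.
  by move=> [n [en nm ->]]; exists n; split=> //; split=> //; exists (greedy D (rho t) n).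
by move=> [n [[en [j [<- h]]] <-]]; exists n.
Qed.

Lemma measurable_osc_quotient d (T : measurableType d) (R : realType)
    (M : metricType R) (D : nat -> M) (K : T -> set M) k q :
  (forall t, K t !=set0) ->
  (forall k q, measurable [set t | sdist (K t) (D k) < q]) ->
  measurable [set t | (forall k, 0 < sdist (K t) (D k)) /\
                      osc_quotient D (K t) (D k) < q].
Proof.
move=> K0 mr; pose rho t k := sdist (K t) (D k).
have mrho : forall k q, measurable [set t | rho t k < q] by exact: mr.
(* The quotient never exceeds 1. For [q] at most 1, a point of the union closer to [D k] than [q]
   times the distance to [K t] cannot lie in [K t], so only the countably many points [D i] have to
   be tested. *)
rewrite (_ : [set t | _] = [set t | (forall k, 0 < sdist (K t) (D k)) /\
  (1 < q \/ (0 < q /\ exists i, greedy_even D (rho t) i /\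
     q^-1 * mdist (D k) (D i) < rho t k))]).
  apply: measurable_and.
    apply: measurable_forall => j; apply: measurable_lt_ray => //.
    by move=> r; exact: measurable_Prop.
  apply: measurable_or; first exact: measurable_Prop.
  apply: measurable_and; first exact: measurable_Prop.
  apply: measurable_exists => i; apply: measurable_and.
    exact: measurable_greedy_even.
  apply: measurable_lt_ray; last exact: mrho.
  by move=> r; exact: measurable_Prop.
apply/seteqP; split=> t /= [pos h]; split=> //.
  have [q1|q1] := ltP 1 q; first by left.
  have /andP[g0 g1] := osc_quotient_itv D (K0 t) (pos k).
  have q0 : 0 < q by exact: le_lt_trans h.
  right; split=> //; move: h; rewrite /osc_quotient ltr_pdivrMr//.
  move=> /sdist_ltP[|y [Ky|[i Fi <-]] hy].
  - by have [y Ky] := K0 t; exists y; left.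
  - exfalso; move: hy; apply/negP; rewrite -leNgt.
    apply: le_trans (sdist_le (D k) Ky).
    by rewrite ler_piMl// ltW.
  - by exists i; split=> //; rewrite mulrC ltr_pdivrMr// mulrC.
case: h => [q1|[q0 [i [Fi hi]]]].
  have /andP[_ g1] := osc_quotient_itv D (K0 t) (pos k).
  exact: le_lt_trans q1.
rewrite /osc_quotient ltr_pdivrMr//; apply/sdist_ltP.
  by have [y Ky] := K0 t; exists y; left.
exists (D i); first by right; exists i.
by move: hi; rewrite mulrC ltr_pdivrMr// mulrC.
Qed.

(* If [K] meets [D] then [osc_quotient] divides by zero on [D]; an unbounded
   sequence, which has no bounded extension, is used instead. *)
Definition osc_seq (R : realType) (M : metricType R) (D : nat -> M) (K : set M)
    (k : nat) : R :=
  if `[< forall j, 0 < sdist K (D j) >] then osc_quotient D K (D k) else k%:R.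

Lemma measurable_osc_seq d (T : measurableType d) (R : realType)
    (M : metricType R) (D : nat -> M) (K : T -> set M) k q :
  (forall t, K t !=set0) ->
  (forall k q, measurable [set t | sdist (K t) (D k) < q]) ->
  measurable [set t | osc_seq D (K t) k < q].
Proof.
move=> K0 mr.
rewrite (_ : [set t | _] = [set t | ((forall k, 0 < sdist (K t) (D k)) /\
                      osc_quotient D (K t) (D k) < q) \/
  (~ (forall k, 0 < sdist (K t) (D k)) /\ k%:R < q)]).
  apply: measurable_or; first exact: measurable_osc_quotient.
  apply: measurable_and; last exact: measurable_Prop.
  apply: measurable_not.
  apply: measurable_forall => j; apply: measurable_lt_ray => //.
  by move=> r; exact: measurable_Prop.
apply/seteqP; split=> t /=; rewrite /osc_seq; case: asboolP => pos.
- by left.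
- by right.
- by move=> [[]|[]].
- by move=> [[]|[]].
Qed.

Lemma osc_seq_extendable (R : realType) (M : metricType R)
    (X : topologicalType) (e : X -> M) (d : nat -> X) (K : set M) :
  dense_embedding e d -> K !=set0 -> closed K ->
  extendable d (osc_seq (e \o d) K) <-> (forall x, ~ K (e x)).
Proof.
move=> de K0 cK; have [ce he dd] := de.
have [pos|npos] := pselect (forall j, 0 < sdist K ((e \o d) j)); last first.
  split=> [[f [_ [B fB] fg]]|nK]; last first.
    by exfalso; apply: npos => j; apply: sdist_gt0 => //; exact: nK.
  exfalso; have := fB (d (Num.truncn B).+1); rewrite fg /osc_seq.
  case: asboolP => // _; rewrite ger0_norm// leNgt => /negP; apply.
  exact: truncnS_gt.
have -> : osc_seq (e \o d) K = fun k => osc_quotient (e \o d) K (e (d k)).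
  by apply/funext => k; rewrite /osc_seq; case: asboolP.
split=> [ex x Kx|nK]; last exact: osc_quotient_extendable.
exact: (osc_quotient_not_extendable de Kx).
Qed.

(** * Hardness *)

Definition cantor : set baire := [set c : baire | forall n, (c n <= 1)%N].

Lemma cantor_compact : compact cantor.
Proof.
have fin : compact [set k : nat | (k <= 1)%N].
  rewrite (_ : [set k | _] = [set 0%N] `|` [set 1%N]).
    by apply: compactU; exact: compact_set1.
  by apply/seteqP; split=> [[|[|k]]//= _|k [->|->]//]; [left|right].
exact: (@tychonoff nat (fun=> nat) (fun=> [set k : nat | (k <= 1)%N]) (fun=> fin)).
Qed.

(* The indicator of the graph of [y]: a closed-graph injection of the Baire
   space into the Cantor space, turning a quantifier over the former into one
   over the latter. *)
Definition bgraph (y : baire) : baire := fun n => (y (nleft n) == nright n) : nat.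

Lemma bgraph_continuous : continuous bgraph.
Proof.
apply/continuous_baireP => y n.
by apply: filterS (near_baire y (nleft n)) => z; rewrite /bgraph => ->.
Qed.

Lemma bgraph_rangeP (c : baire) : range bgraph c <->
  [/\ forall n, (c n <= 1)%N, forall i, exists j, c (npair i j) = 1%N &
      forall i j k, c (npair i j) = 1%N -> c (npair i k) = 1%N -> j = k].
Proof.
split=> [[y _ <-]|[c1 cex cun]].
  split=> [n|i|i j k]; rewrite /bgraph.
  - by case: (_ == _).
  - by exists (y i); rewrite nleft_npair nright_npair eqxx.
  - by rewrite !nleft_npair !nright_npair; do 2 case: eqP => //; move=> <- <-.
have [y hy] := choice cex.
exists (y : baire) => //; apply/funext => n; rewrite /bgraph.
case: eqP => [yn|yn]; first by rewrite -(npair_left_right n) -yn hy.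
have := c1 n; rewrite leq_eqVlt => /orP[/eqP cn|]; last by case: (c n).
by exfalso; apply: yn; apply: (cun _ _ _ (hy _)); rewrite npair_left_right.
Qed.

Lemma closed_eq_baire (T : topologicalType) (f g : T -> baire) :
  continuous f -> continuous g -> closed [set t | f t = g t].
Proof.
move=> /continuous_baireP cf /continuous_baireP cg.
rewrite -[X in closed X]setCK; apply: open_closedC; rewrite openE => t fg.
have [n hn] : exists n, f t n <> g t n.
  by apply: contrapT => /forallNP h; apply: fg; apply/funext => n;
    apply: contrapT; exact: h.
rewrite /interior; apply: filterS2 (cf t n) (cg t n) => u fu gu fgu.
by apply: hn; rewrite -fu -gu fgu.
Qed.

Lemma closed_eq_metric (R : realType) (M : metricType R) (T : topologicalType)
    (f g : T -> M) : continuous f -> continuous g -> closed [set t | f t = g t].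
Proof.
move=> cf cg.
rewrite -[X in closed X]setCK; apply: open_closedC; rewrite openE => t fg.
have r0 : 0 < mdist (f t) (g t) / 2.
  by rewrite divr_gt0// mdist_gt0; apply/eqP.
have nf : \forall u \near t, mdist (f u) (f t) < mdist (f t) (g t) / 2.
  by apply: near_embed => //; rewrite mdistxx.
have ng : \forall u \near t, mdist (g u) (g t) < mdist (f t) (g t) / 2.
  by apply: near_embed => //; rewrite mdistxx.
rewrite /interior; apply: filterS2 nf ng => u fu gu fgu.
have := metric_triangle (f t) (f u) (g t).
by rewrite [mdist (f t) (f u)]metric_sym {2}fgu; lra.
Qed.

Lemma bgraph_range_Pi1 (R : realType) m : Pi1 m.+1 (range bgraph).
Proof.
have [cl op] := Sigma1_closed_open m (baire_open_fsigma R).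
have opn (P : pred nat) n : Sigma1 m.+1 [set c : baire | P (c n)].
  apply: op; rewrite openE => c Pc; rewrite /interior.
  by apply: filterS (near_baire c n) => z /= ->.
rewrite /Pi1 (_ : ~` _ = (\bigcup_n [set c : baire | (1 < c n)%N]) `|`
  (\bigcup_i \bigcap_j [set c : baire | c (npair i j) != 1%N]) `|`
  (\bigcup_i \bigcup_j \bigcup_k ([set c : baire | j <> k] `&`
    ([set c : baire | c (npair i j) == 1%N] `&`
     [set c : baire | c (npair i k) == 1%N])))).
  apply: Sigma1_setU; first apply: Sigma1_setU.
  - by apply: Sigma1_bigcup => n; exact: (opn (fun x => 1 < x)%N).
  - apply: Sigma1_bigcup => i; apply: Sigma1_bigcap => j.
    exact: (opn (fun x => x != 1%N)).
  - apply: Sigma1_bigcup => i; apply: Sigma1_bigcup => j; apply: Sigma1_bigcup => k.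
    apply: Sigma1_setI; first exact: Sigma1_cst (baire_open_fsigma R).
    by apply: Sigma1_setI; exact: (opn (fun x => x == 1%N)).
apply/seteqP; split=> c.
  move=> nc; apply: contrapT => h; apply: nc; apply/bgraph_rangeP; split.
  - move=> n; rewrite leqNgt; apply/negP => cn; apply: h; left; left.
    by exists n.
  - move=> i; apply: contrapT => /forallNP hi; apply: h; left; right.
    by exists i => // j _; apply/eqP; exact: hi.
  - move=> i j k cj ck; apply: contrapT => jk; apply: h; right.
    by exists i => //; exists j => //; exists k => //=; rewrite cj ck.
move=> h /bgraph_rangeP[c1 cex cun]; case: h => [[[n _ /=]|[i _ hi]]|].
- by rewrite ltnNge c1.
- by have [j cj] := cex i; have /eqP := hi j I.
- by move=> [i _ [j _ [k _ /= [jk [/eqP cj /eqP ck]]]]]; exact/jk/(cun i).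
Qed.

(** A graph [bgraph y] determines [y], so the complement of the set [A] can also be stated with an
    existential quantifier: either [bsnd z] is no graph, or it is the graph of some [y] outside the
    section of [C]. This keeps [A] in the class [Pi1 m.+1], although its definition begins with an
    existential quantifier. *)
Lemma compact_quantifier (R : realType) m (C : set (baire * baire)) :
  Sigma1 m.+1 (~` C) -> exists A : set baire, Pi1 m.+1 A /\
    forall s, (exists y, C (s, y)) <-> (exists c, cantor c /\ A (bpair s c)).
Proof.
move=> sC.
have bf := baire_open_fsigma R.
have [cl op] := Sigma1_closed_open m (open_fsigma_prod bf).
exists [set z | exists y, bsnd z = bgraph y /\ C (bfst z, y)]; split.
  rewrite /Pi1 (_ : ~` _ = bsnd @^-1` (~` range bgraph) `|`
    fst @` ([set u : baire * baire | bsnd u.1 = bgraph u.2] `&`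
      (fun u : baire * baire => (bfst u.1, u.2)) @^-1` (~` C))).
    apply: Sigma1_setU.
      exact: (Sigma1_preimage bsnd_continuous (bgraph_range_Pi1 R m)).
    apply: Sigma1_proj; apply: Sigma1_setI.
      apply: cl; apply: closed_eq_baire.
        exact: (continuous_compose bsnd_continuous (@continuous_fst baire baire)).
      exact: (continuous_compose bgraph_continuous (@continuous_snd baire baire)).
    apply: Sigma1_preimage sC; apply: continuous_pair.
      exact: (continuous_compose bfst_continuous (@continuous_fst baire baire)).
    exact: continuous_snd.
  apply/seteqP; split=> z.
    move=> nz; have [[y _ yz]|ng] := pselect (range bgraph (bsnd z)); last by left.
    right; exists (z, y) => //; split=> //= Cy; apply: nz; by exists y.
  move=> h [y [zy Cy]]; case: h => [/= h|[[z' y'] [/= zy' nC] zz]].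
    by apply: h; rewrite zy; exists y.
  subst z'; apply: nC; suff -> : y' = y by [].
  apply/funext => i; rewrite zy in zy'.
  have := congr1 (fun c : baire => c (npair i (y i))) zy'.
  rewrite /bgraph nleft_npair nright_npair eqxx /=.
  by case: eqP.
move=> s; split=> [[y Cy]|[c [_ [y [_]]]]].
  exists (bgraph y); split.
    by have /bgraph_rangeP[] : range bgraph (bgraph y) by exists y.
  by exists y; rewrite bsnd_bpair bfst_bpair.
by rewrite bfst_bpair => Cy; exists y.
Qed.

Lemma bcode_inj (T : topologicalType) (p : baire -> T) (s : T -> baire) g g' :
  borel_section p s -> bcode s g = bcode s g' -> g = g'.
Proof. by move=> bs h; rewrite -(bcodeK g bs) h bcodeK. Qed.

Lemma measurable_section_comp d (S : measurableType d) (T : topologicalType)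
    (p : baire -> T) (s : T -> baire) (f : S -> T) :
  borel_section p s ->
  (forall V : set T, open V -> measurable (f @^-1` V)) ->
  forall n i, measurable [set t | s (f t) n = i].
Proof.
move=> [_ _ lev] mf n i; have [V1 [V2 [vop1 vop2 E]]] := lev n i.
rewrite (_ : [set t | _] = f @^-1` V1 `\` f @^-1` V2).
  by apply: measurableD; exact: mf.
by rewrite setDE preimage_setC -preimage_setI -setDE -E.
Qed.

Definition compact_section (M : Type) (H : baire -> M) (s : baire) : set M :=
  (fun c => H (bpair s c)) @` cantor.

Lemma bpair_continuous_r s : continuous (bpair s).
Proof.
apply: (continuous_compose (f := fun c => (s, c)) bpair_continuous).
by apply: continuous_pair; [move=> c; exact: cvg_cst|exact: continuous_id].
Qed.

Lemma bpair_continuous_l c : continuous (bpair ^~ c).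
Proof.
apply: (continuous_compose (f := fun s => (s, c)) bpair_continuous).
by apply: continuous_pair; [exact: continuous_id|move=> s; exact: cvg_cst].
Qed.

Lemma compact_section_neq0 (M : Type) (H : baire -> M) s :
  compact_section H s !=set0.
Proof. by exists (H (bpair s (fun=> 0%N))); exists (fun=> 0%N). Qed.

Lemma compact_section_closed (R : realType) (M : metricType R) (H : baire -> M) s :
  continuous H -> closed (compact_section H s).
Proof.
move=> cH; apply: compact_closed; first exact: metric_hausdorff.
apply: continuous_compact cantor_compact; apply: continuous_subspaceT.
exact: (continuous_compose cH (@bpair_continuous_r s)).
Qed.

(** The distance to the compact section is an infimum, over the fixed set [cantor], of continuous
    functions of [s], hence upper semicontinuous. *)
Lemma compact_section_open (R : realType) (M : metricType R) (H : baire -> M) x q :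
  continuous H -> open [set s | sdist (compact_section H s) x < q].
Proof.
move=> cH; rewrite (_ : [set s | _] =
    \bigcup_(c in cantor) [set s | mdist (H (bpair s c)) x < q]).
  apply: bigcup_open => c _.
  exact: (open_preimage (continuous_compose cH (@bpair_continuous_l c))
    (open_mdist_lt x q)).
apply/seteqP; split=> s /=.
  move=> /(sdist_ltP _ _ (compact_section_neq0 H s))[_ [c cc <-] h].
  by exists c => //=; rewrite metric_sym.
move=> [c cc /= h]; apply/(sdist_ltP _ _ (compact_section_neq0 H s)).
by exists (H (bpair s c)); [exists c|rewrite metric_sym].
Qed.

Lemma polish_section (R : realType) (P : topologicalType) :
  polish R P -> P -> exists (M : metricType R) (h : P -> M) (g : M -> P),
    [/\ continuous h, continuous g, cancel h g & cancel g h] /\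
    exists (p : baire -> M) (s : M -> baire), borel_section p s.
Proof.
move=> [[D cD dD] [M [h [cM [ch [g cg [hK gK]]]]]]] x0.
have [y [_ Dy]] := dD setT (ex_intro _ x0 I) openT.
have [q qD] := countable_ne_enum cD (ex_intro _ y Dy).
have dq : dense (range (h \o q)).
  move=> U [x Ux] oU.
  have [|z [hUz]] := dD (h @^-1` U) _ (open_preimage ch oU).
    by exists (g x); rewrite /= gK.
  by rewrite -qD => -[n _ nz]; exists (h z); split=> //; exists n => //=; rewrite nz.
have [p [s [cp ps lev]]] := polish_param cM dq.
by exists M, h, g; split=> //; exists p, s.
Qed.

Lemma embedding_dense (R : realType) (M : metricType R) (X P : topologicalType)
    (f : X -> P) (h : P -> M) (g : M -> P) (d : nat -> X) :
  embedding f -> continuous h -> continuous g -> cancel h g -> cancel g h ->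
  dense (range d) -> dense_embedding (h \o f) d.
Proof.
move=> [finj cf fo] ch cg hK gK dd; split=> //.
  exact: (continuous_compose ch cf).
move=> x U; rewrite nbhsE => -[W [oW Wx] WU].
have [V oV VE] := fo W oW.
have Vx : (V `&` range f) (f x) by rewrite -VE; exists x.
have : nbhs (h (f x)) (g @^-1` V).
  apply: open_nbhs_nbhs; split; first exact: open_preimage.
  by rewrite /= hK; case: Vx.
move=> /nbhs_mdist_exP[e e0 eV]; have [r re] := exists_invX2_lt e0.
exists r => y yx; apply: WU.
have : (V `&` range f) (f y).
  split; last by exists y.
  rewrite -(hK (f y)); apply: eV; rewrite metric_sym; exact: lt_trans re.
by rewrite -VE => -[z Wz /finj <-].
Qed.

(** [A] is the projection of the pairs (x, z) with [p z = x] and z in the preimage of [A]. Failure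
    to be [Sigma1] thus passes from a subset of [M] to its set of codes, to which [wadge_reduction]
    applies. *)
Lemma Sigma1_param (R : realType) (M : metricType R) (p : baire -> M)
    (s : M -> baire) m (A : set M) : borel_section p s ->
  Sigma1 m.+1 (p @^-1` A) -> Sigma1 m.+1 A.
Proof.
move=> [cp ps _] sA.
rewrite (_ : A = fst @` ([set u : M * baire | p u.2 = u.1] `&`
    snd @^-1` (p @^-1` A))); last first.
  apply/seteqP; split=> [x Ax|x [[x' z] [/= <- Az] <-]//].
  by exists (x, s x) => //; split; rewrite /= ps.
apply: Sigma1_proj; apply: Sigma1_setI; last first.
  exact: (Sigma1_preimage (@continuous_snd M baire) sA).
have [cl _] := Sigma1_closed_open m (open_fsigma_prod (@metric_open_fsigma R M)).
apply: cl; apply: closed_eq_metric; last exact: continuous_fst.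
exact: (continuous_compose cp (@continuous_snd M baire)).
Qed.

Lemma code_range_hard (R : realType) (M : metricType R) (X : topologicalType)
    (e : X -> M) (d : nat -> X) (pR : baire -> R) (sR : R -> baire)
    (pM : baire -> M) (sM : M -> baire) m :
  projective_determinacy -> dense_embedding e d ->
  borel_section pR sR -> borel_section pM sM ->
  Sigma1 m.+2 (range e) -> ~ Sigma1 m.+1 (range e) ->
  @borel_hard R (@Pi1 m.+2) _ (borel baire) (code_range sR d).
Proof.
move=> pd de bsR bsM sX nX d' S B _ [P [f [polP [mf [f' mf' [fK f'K]]] pB]]].
have [cpM _ _] := bsM.
have [M' [h [g [[ch cg hK gK] [p [s bs]]]]]] := polish_section polP point.
have [cp ps _] := bs.
(* The Polish space behind [S] is replaced by the Baire space: [B'] consists of the codes of points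
   of [B], and [tau] is a Borel choice of codes. *)
pose B' : set baire := (fun z => g (p z)) @^-1` (f @` B).
have pB' : Pi1 m.+2 B'.
  by rewrite /Pi1 preimage_setC; apply: Sigma1_preimage pB; exact: continuous_compose.
pose tau (t : S) := s (h (f t)).
have tauB t : B t <-> B' (tau t).
  rewrite /B' /tau /= ps hK; split=> [Bt|[t' Bt' ft]]; first by exists t.
  by rewrite -(fK t) -ft fK.
(* By definition of the classes, the complement of [B'] is a projection of [C], whose own complement
   is one level lower. *)
have [C sC CE] := pB'.
have [A [pA AC]] := compact_quantifier R sC.
(* The reduction goes to the codes of points of [range e]; composing it with [pM] gives the map [H]
   into [M]. *)
have [H0 cH0 AE] := wadge_reduction R pd (ltn0Sn m) (ltn0Sn m.+1) pA
  (Sigma1_preimage cpM sX) (fun h => nX (Sigma1_param bsM h)).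
pose H z := pM (H0 z).
have cH : continuous H by exact: continuous_compose.
have KB z : B' z <-> forall x, ~ compact_section H z (e x).
  split=> [Bz x [c cc Hc]|nK].
    have : (~` B') z by rewrite CE; have [_] := AC z; case;
      [exists c; split=> //; rewrite AE; exists x|move=> y Cy; exists (z, y)].
    by apply.
  apply: contrapT => nB; have : (~` B') z by [].
  rewrite CE => -[[z' y] Cy /= zz]; subst z'.
  have [h1 _] := AC z; have [c [cc]] := h1 (ex_intro _ y Cy).
  by rewrite AE => -[x _ xE]; apply: (nK x); exists c.
pose F (t : S) : borel baire := bcode sR (osc_seq (e \o d) (compact_section H (tau t))).
exists F.
  have otau : measurable_fun setT (tau : S -> borel baire).
    apply: measurable_to_baire; apply: (measurable_section_comp (f := h \o f) bs).
    move=> V oV; have oV' := open_preimage ch oV.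
    have mV : measurable (h @^-1` V : set (borel P)) by exact: sub_sigma_algebra.
    by have := mf measurableT _ mV; rewrite setTI.
  apply: measurable_to_baire => n i.
  apply: (measurable_section_comp
    (f := fun t => osc_seq (e \o d) (compact_section H (tau t)) (nleft n)) bsR).
  move=> V oV; apply: measurable_ray_open => // q.
  apply: measurable_osc_seq => [t|k r]; first exact: compact_section_neq0.
  have oK := compact_section_open ((e \o d) k) r cH.
  have mK : measurable ([set s | sdist (compact_section H s) ((e \o d) k) < r]
      : set (borel baire)) by exact: sub_sigma_algebra.
  by have := otau measurableT _ mK; rewrite setTI.
apply/seteqP; split=> t.
  move=> /tauB /KB nK; exists (osc_seq (e \o d) (compact_section H (tau t))); split=> //.
  by apply/(osc_seq_extendable de) => //; [exact: compact_section_neq0|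
    exact: compact_section_closed].
move=> [g' [ex /(bcode_inj bsR) gE]]; apply/tauB/KB.
by apply/(osc_seq_extendable de); [exact: compact_section_neq0|
  exact: compact_section_closed|rewrite gE].
Qed.

Lemma borel_baire_in_class (R : realType) m (A : set (borel baire)) :
  Pi1 m (A : set baire) -> @in_class R (@Pi1 m) _ (borel baire) A.
Proof.
move=> pA; exists baire, (id : borel baire -> borel baire); split.
- exact: baire_polish.
- by split; [exact: measurable_id|exists id; [exact: measurable_id|]].
- by rewrite image_id.
Qed.

Lemma borel_baire_standard (R : realType) : @standard_borel R _ (borel baire).
Proof.
exists baire, (id : borel baire -> borel baire); split; first exact: baire_polish.
by split; [exact: measurable_id|exists id; [exact: measurable_id|]].
Qed.

Theorem theorem11 (R : realType) (X : topologicalType)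
    (pd : projective_determinacy)
    (X_separable : separable X) (X_metrizable : metrizable R X)
    (X_projective : projective_space R X)
    (X_not_Sigma11 : ~ space_in R (Sigma1 1) X)
    (n : nat) (n_ge2 : (2 <= n)%N)
    (X_Sigma1n : space_in R (Sigma1 n) X)
    (n_least : forall m : nat, (1 <= m)%N -> space_in R (Sigma1 m) X -> (n <= m)%N) :
  borel_complete_space R (Pi1 n) (Cp_star R X).
Proof.
case: n n_ge2 X_Sigma1n n_least => [//|[//|m]] _ [P [f [polP ef sP]]] n_least.
(* An empty space would be in [Sigma1 1], its image being a closed set. *)
have [x0 _] : exists x : X, True.
  apply: contrapT => /forallNP nX; apply: X_not_Sigma11; exists P, f; split=> //.
  exists set0; first exact: closed0.
  by rewrite image_set0; apply/seteqP; split=> // z [x _ _]; have := nX x.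
have [M [h [g [[ch cg hK gK] [pM [sM bsM]]]]]] := polish_section polP (f x0).
have [D cD dD] := X_separable.
have [y [_ Dy]] := dD setT (ex_intro _ x0 I) openT.
have [d dE] := countable_ne_enum cD (ex_intro _ y Dy).
rewrite -dE in dD.
have de := embedding_dense ef ch cg hK gK dD.
have [pR [sR bsR]] := real_param R.
have rE : range (h \o f) = g @^-1` (range f).
  apply/seteqP; split=> [_ [x _ <-]|z [x _ xz]]; first by exists x; rewrite //= hK.
  by exists x; rewrite //= xz gK.
have sX : Sigma1 m.+2 (range (h \o f)) by rewrite rE; exact: Sigma1_preimage sP.
(* With n = m + 2, the level m + 1 is the one just below n; a set at that level would pull back
   along [h] to the original Polish space and contradict minimality. *)
have nX : ~ Sigma1 m.+1 (range (h \o f)).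
  move=> sm; suff : (m.+2 <= m.+1)%N by rewrite ltnn.
  apply: n_least => //; exists P, f; split=> //.
  rewrite (_ : range f = h @^-1` range (h \o f)); first exact: Sigma1_preimage sm.
  by rewrite rE -comp_preimage (_ : g \o h = id)//; apply/funext.
exists _, (borel baire), (@Cp_code R X sR d); split.
- exact: borel_baire_standard.
- exact: Cp_code_embedding de bsR.
- rewrite range_Cp_code; split; first exact: code_range_hard bsR bsM sX nX.
  by apply: borel_baire_in_class; exact: code_range_Pi1 de bsR bsM sX.
Qed.
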